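(* (1) There is a computable function $f$ and an algorithm that, given an instance $(G,S,T,k,\ell)$ of \textsc{Token Jumping Optimization} in which $G$ is $d$-degenerate, correctly decides it in time $f(k+\ell+d)\cdot n^{O(1)}$. (2) There is a computable function $g$ and an algorithm that, given an instance $(G,S,T,k,\ell)$ of \textsc{Token Jumping Optimization} together with a set $N\subseteq V(G)$ and an integer $d$ such that $G-N$ is $d$-degenerate, correctly decides it in time $g(|N|+k+\ell+d)\cdot n^{O(1)}$. Here $n=|V(G)|$.
   Context: All graphs are finite, simple and undirected. A graph is $d$-degenerate if every induced subgraph has a vertex of degree at most $d$. An instance of \textsc{Token Jumping Optimization} is $(G,S,T,k,\ell)$ where $G$ is a graph, $S,T$ are independent sets of $G$ of size $k\ge1$, and $\ell\ge1$ an integer; it is a yes-instance iff there is a sequence $S=I_0,I_1,\dots,I_{\ell'}=T$ with $\ell'\le\ell$ such that every $I_j$ is an independent set of size $k$ and for each $j$ there are $u\in I_j$, $v\in V(G)\setminus I_j$ with $I_{j+1}=(I_j\setminus\{u\})\cup\{v\}$ (a token jumps from $u$ to $v$; no adjacency between $u$ and $v$ is required). *)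

(* Defs.v *)
From mathcomp Require Import all_boot.
Set Implicit Arguments. Unset Strict Implicit. Unset Printing Implicit Defensive.

(* A finite simple graph on vertex set 'I_n is a symmetric irreflexive
   relation e : rel 'I_n (the hypotheses are stated in the theorem). *)

Definition indep (n : nat) (e : rel 'I_n) (I : {set 'I_n}) : bool :=
  [forall x in I, forall y in I, ~~ e x y].

Definition tjump (n : nat) (I J : {set 'I_n}) : bool :=
  [exists u in I, exists v in ~: I, J == v |: (I :\ u)].

Definition tjo_instance (n : nat) (e : rel 'I_n) (S T : {set 'I_n})
    (k l : nat) : Prop :=
  [/\ 1 <= k, 1 <= l, indep e S & indep e T] /\ #|S| = k /\ #|T| = k.

Definition tjo_yes (n : nat) (e : rel 'I_n) (S T : {set 'I_n})
    (k l : nat) : Prop :=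
  exists p : seq {set 'I_n},
    [/\ size p <= l, path (@tjump n) S p, last S p = T
      & all (fun I => indep e I && (#|I| == k)) (S :: p)].

Definition degenerate (n : nat) (e : rel 'I_n) (d : nat) : Prop :=
  forall A : {set 'I_n}, A != set0 ->
    exists2 x, x \in A & #|[set y in A | e x y]| <= d.

Definition degenerate_minus (n : nat) (e : rel 'I_n) (N : {set 'I_n})
    (d : nat) : Prop :=
  forall A : {set 'I_n}, A != set0 -> A \subset ~: N ->
    exists2 x, x \in A & #|[set y in A | e x y]| <= d.

(* Registers indexed by nat holding nats; instructions: constants, addition,
   truncated subtraction, indirect load/store, conditional/unconditional
   jumps and halt (no multiplication, so unit cost is the standard RAM). *)
Inductive instr : Type :=
  | IConst of nat & nat
  | IAdd of nat & nat & nat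
  | ISub of nat & nat & nat
  | ILoad of nat & nat
  | IStore of nat & nat
  | IJz of nat & nat
  | IJmp of nat
  | IHalt.

Definition program := seq instr.
Definition memory := nat -> nat.

Definition upd (m : memory) (r v : nat) : memory :=
  fun i => if i == r then v else m i.

(* exec P t pc m = Some m' iff the machine, started at pc with memory m,
   halts within t steps (each instruction, including Halt, costs one step),
   with final memory m'. Falling off the program counts as halting. *)
Fixpoint exec (P : program) (t pc : nat) (m : memory) : option memory :=
  match t with
  | 0 => None
  | t'.+1 =>
    match nth IHalt P pc with
    | IHalt => Some m
    | IConst r c => exec P t' pc.+1 (upd m r c)
    | IAdd r a b => exec P t' pc.+1 (upd m r (m a + m b))
    | ISub r a b => exec P t' pc.+1 (upd m r (m a - m b))
    | ILoad r a => exec P t' pc.+1 (upd m r (m (m a)))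
    | IStore a r => exec P t' pc.+1 (upd m (m a) (m r))
    | IJz r tg => exec P t' (if m r == 0 then tg else pc.+1) m
    | IJmp tg => exec P t' tg m
    end
  end.

Definition init (inp : seq nat) : memory := fun i => nth 0 inp i.

Definition accepts (m : memory) : bool := m 0 != 0.

Definition ram_computable (f : nat -> nat) : Prop :=
  exists P : program, forall x, exists t m,
    exec P t 0 (init [:: x]) = Some m /\ m 0 = f x.

Definition enc_set (n : nat) (A : {set 'I_n}) : seq nat :=
  [seq nat_of_bool (x \in A) | x <- enum 'I_n].

Definition enc_graph (n : nat) (e : rel 'I_n) : seq nat :=
  [seq nat_of_bool (e x y) | x <- enum 'I_n, y <- enum 'I_n].

Definition enc_inst (n : nat) (e : rel 'I_n) (S T : {set 'I_n}) (k l : nat)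
  : seq nat :=
  [:: n, k & l :: enc_graph e ++ enc_set S ++ enc_set T].

Definition enc_inst_mod (n : nat) (e : rel 'I_n) (S T : {set 'I_n})
    (k l : nat) (N : {set 'I_n}) (d : nat) : seq nat :=
  enc_inst e S T k l ++ d :: enc_set N.

(* Main.v *)
(* A sequence of [l] moves involves [K = k + l] variables: the [k] initial
   tokens and one target vertex per move.  A plan says which earlier variable
   is replaced by each target; two variables conflict when they are occupied
   at a common time, and a solution assigns vertices to the variables so that
   conflicting ones are distinct and non-adjacent, the first [k] lie in [S] and
   the never replaced ones lie in [T].

   For a fixed plan, repeatedly pick the unassigned variable with the fewest
   candidate vertices and try its first [B] candidates.  If some branch reaches
   a state where all lists are longer than [B >= (d + 1) K], then a solution
   exists among the first [B] candidates of each list: a vertex of degree at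
   most [d] in the union of the lists can be given to a list containing it, at
   the price of at most [d + 1] vertices in every other list.  So enumerating
   the plan and the branches as the digits of a number in base [B], for
   [B = K + 1, K + 2, ...], and stopping as soon as a solution is found or no
   list was truncated, is correct for every graph, and stops before [B] exceeds
   [(d + 1) K + 1] on [d]-degenerate graphs, without knowing [d].  If [G - N]
   is [d]-degenerate, then [G] is [|N| + d]-degenerate, which gives (2). *)

Require Import Defs.
From mathcomp Require Import all_boot.
From mathcomp Require Import zify.
From Stdlib Require Import FunctionalExtensionality.

Set Implicit Arguments. Unset Strict Implicit. Unset Printing Implicit Defensive.

(** * A structured language compiled to the machine *)

(** Branching on a shortest list is what gives the truncation flag its meaning: if that list exceeds
    [B], all of them do, and in a degenerate graph this is the situation in which independent
    transversals exist. The solution obtained there can be reached with digits below [B], because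
    lists only shrink as variables receive values, so the position of a fixed value in its list
    never grows. The bases start above [K] so that the same base also holds the digits of the plan,
    which are names of variables. Once [B] exceeds [n] no list can be truncated, so [n] bases are
    enough. There are [B ^ (l + K)] branches, and reading a digit by repeated subtraction takes
    about as many steps; this only affects the exponent, since all loops are bounded by the product
    of a parameter function and [n]. The time analysis is therefore syntactic: when no loop bound is
    modified, the cost is polynomial in the largest bound, with the nesting depth as degree. The
    machine can neither multiply nor divide, and its input fills the low addresses; this dictates
    the arithmetic by loops, the small compiled language and the relocation of the input. *)

Inductive expr : Type :=
  | Cst of nat
  | Get of nat & expr
  | Plus of expr & expr
  | Minus of expr & expr.

Inductive com : Type :=
  | Skip
  | Put of nat & expr & expr
  | Seq of com & com
  | If of expr & com & com
  | For of nat & com.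

(* [s j i] is cell [i] of array [j]; a scalar is cell 0 of its array. *)
Definition store := nat -> nat -> nat.

Definition sset (s : store) (j i v : nat) : store :=
  fun j' i' => if (j' == j) && (i' == i) then v else s j' i'.

Fixpoint ev (e : expr) (s : store) : nat :=
  match e with
  | Cst c => c
  | Get j a => s j (ev a s)
  | Plus a b => ev a s + ev b s
  | Minus a b => ev a s - ev b s
  end.

(** A loop bound is read once, on entry, so every program terminates and its meaning is a total
    function on stores. *)
Fixpoint den (c : com) (s : store) : store :=
  match c with
  | Skip => s
  | Put j a e => sset s j (ev a s) (ev e s)
  | Seq c1 c2 => den c2 (den c1 s)
  | If e c1 c2 => if ev e s != 0 then den c1 s else den c2 s
  | For x c => iter (s x 0) (den c) s
  end.

Notation base := 12 (only parsing).

(* Cell [i] of array [j] lives at address [base + 32 * i + j], so that the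
   arrays are disjoint and unbounded; the registers below [base] serve as a
   stack of temporaries and loop counters, with top [d]. *)
Definition addr_code (j d : nat) : program :=
  nseq 5 (IAdd d d d) ++ [:: IConst d.+1 (base + j); IAdd d d d.+1].

Lemma size_addr_code j d : size (addr_code j d) = 7.
Proof. by []. Qed.

Fixpoint ecode (e : expr) (d : nat) : program :=
  match e with
  | Cst c => [:: IConst d c]
  | Get j a => ecode a d ++ addr_code j d ++ [:: ILoad d d]
  | Plus a b => ecode a d ++ ecode b d.+1 ++ [:: IAdd d d d.+1]
  | Minus a b => ecode a d ++ ecode b d.+1 ++ [:: ISub d d d.+1]
  end.

Fixpoint esize (e : expr) : nat :=
  match e with
  | Cst _ => 1
  | Get _ a => esize a + 8
  | Plus a b | Minus a b => esize a + esize b + 1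
  end.

Fixpoint csize (c : com) : nat :=
  match c with
  | Skip => 0
  | Put _ a e => esize a + esize e + 8
  | Seq c1 c2 => csize c1 + csize c2
  | If e c1 c2 => esize e + csize c1 + csize c2 + 2
  | For _ c => csize c + 13
  end.

Fixpoint ccode (c : com) (d pc : nat) : program :=
  match c with
  | Skip => [::]
  | Put j a e => ecode a d ++ addr_code j d ++ ecode e d.+1
                 ++ [:: IStore d d.+1]
  | Seq c1 c2 => ccode c1 d pc ++ ccode c2 d (pc + csize c1)
  | If e c1 c2 =>
      ecode e d ++ [:: IJz d (pc + esize e + csize c1 + 2)]
      ++ ccode c1 d (pc + esize e + 1)
      ++ [:: IJmp (pc + csize (If e c1 c2))]
      ++ ccode c2 d (pc + esize e + csize c1 + 2)
  | For x c =>
      ecode (Get x (Cst 0)) d ++ [:: IJz d (pc + csize (For x c))]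
      ++ ccode c d.+1 (pc + 10)
      ++ [:: IConst d.+1 1; ISub d d d.+1; IJmp (pc + 9)]
  end.

(** Static check that the temporaries used from stack top [d] upwards stay below [base], and that
    array numbers stay below 32, the stride of the memory layout. *)
Fixpoint ewf (e : expr) (d : nat) : bool :=
  match e with
  | Cst _ => d < base
  | Get j a => [&& j < 32, ewf a d & d.+1 < base]
  | Plus a b | Minus a b => ewf a d && ewf b d.+1
  end.

Fixpoint cwf (c : com) (d : nat) : bool :=
  match c with
  | Skip => true
  | Put j a e => [&& j < 32, ewf a d, ewf e d.+1 & d.+1 < base]
  | Seq c1 c2 => cwf c1 d && cwf c2 d
  | If e c1 c2 => [&& ewf e d, cwf c1 d & cwf c2 d]
  | For x c => [&& x < 32, d.+1 < base & cwf c d.+1]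
  end.

(** An upper bound on the number of steps. A loop pays 9 steps to load its counter and 1 for the
    final test; each iteration adds 4 for the test, the decrement (two instructions) and the jump
    back. *)
Fixpoint cost (c : com) (s : store) : nat :=
  match c with
  | Skip => 0
  | Put _ a e => esize a + esize e + 8
  | Seq c1 c2 => cost c1 s + cost c2 (den c1 s)
  | If e c1 c2 => esize e + 2 + (if ev e s != 0 then cost c1 s else cost c2 s)
  | For x c => 10 + \sum_(i < s x 0) (cost c (iter i (den c) s) + 4)
  end.

(** * Correctness and step count of compiled code *)

Lemma ewfS e d : ewf e d -> d < base.
Proof.
elim: e d => [c|j a IHa|a IHa b IHb|a IHa b IHb] d //=.
- by case/and3P=> _ /IHa.
- by case/andP=> /IHa.
- by case/andP=> /IHa.
Qed.

Lemma size_ecode e d : size (ecode e d) = esize e.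
Proof.
elim: e d => [c|j a IHa|a IHa b IHb|a IHa b IHb] d //=; rewrite !size_cat /=.
- by rewrite IHa.
- by rewrite IHa IHb addnA.
- by rewrite IHa IHb addnA.
Qed.

Lemma size_ccode c d pc : size (ccode c d pc) = csize c.
Proof.
elim: c d pc => [|j a e|c1 IH1 c2 IH2|e c1 IH1 c2 IH2|x c IHc] d pc //=;
  do 3 rewrite ?size_cat /=; rewrite ?size_ecode ?IH1 ?IH2 ?IHc; lia.
Qed.

(* [runs P pc m t pc' m']: from [pc] and [m], the machine is at [pc'] with
   memory [m'] after exactly [t] steps. *)
Definition runs (P : program) (pc : nat) (m : memory) (t pc' : nat)
    (m' : memory) : Prop :=
  forall t2, exec P (t + t2) pc m = exec P t2 pc' m'.

Lemma runs0 P pc m : runs P pc m 0 pc m.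
Proof. by []. Qed.

Lemma runs_trans P pc m t1 pc1 m1 t2 pc2 m2 :
  runs P pc m t1 pc1 m1 -> runs P pc1 m1 t2 pc2 m2 ->
  runs P pc m (t1 + t2) pc2 m2.
Proof. by move=> H1 H2 t; rewrite -addnA H1 H2. Qed.

Definition code_at (P : program) (pc : nat) (c : program) : Prop :=
  forall i, i < size c -> nth IHalt P (pc + i) = nth IHalt c i.

Lemma code_at_cat P pc c1 c2 :
  code_at P pc (c1 ++ c2) -> code_at P pc c1 /\ code_at P (pc + size c1) c2.
Proof.
move=> H; split=> i Hi.
  by rewrite H ?nth_cat ?Hi // size_cat ltn_addr.
rewrite -addnA H ?size_cat ?ltn_add2l // nth_cat.
by rewrite ltnNge leq_addr /= addKn.
Qed.

Lemma code_at_hd P pc i c :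
  code_at P pc (i :: c) -> nth IHalt P pc = i /\ code_at P pc.+1 c.
Proof.
move=> H; split; first by rewrite -[pc]addn0 H.
by move=> j Hj; rewrite addSn -addnS H.
Qed.

Lemma code_at_mid a b c : code_at (a ++ b ++ c) (size a) b.
Proof.
move=> i Hi; rewrite nth_cat ltnNge leq_addr /= addKn.
by rewrite nth_cat Hi.
Qed.

Definition seteq (m m' : memory) (d : nat) : Prop :=
  forall r, (r < d) || (base <= r) -> m' r = m r.

Definition represents (s : store) (m : memory) : Prop :=
  forall j i, j < 32 -> m (base + 32 * i + j) = s j i.

Lemma represents_seteq s m m' d : seteq m m' d -> represents s m -> represents s m'.
Proof. by move=> H R j i Hj; rewrite H ?R //; apply/orP; right; lia. Qed.

Lemma seteq_trans m1 m2 m3 d d' : d <= d' ->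
  seteq m1 m2 d -> seteq m2 m3 d' -> seteq m1 m3 d.
Proof.
move=> Hd H1 H2 r Hr; rewrite H2 ?H1 //.
by case/orP: Hr => Hr; apply/orP; [left|right]; lia.
Qed.

Lemma seteq_upd m r v d : d <= r < base -> seteq m (upd m r v) d.
Proof. by move=> Hr i Hi; rewrite /upd; case: eqP => // E; lia. Qed.

Lemma represents_upd s m j i v : j < 32 -> represents s m ->
  represents (sset s j i v) (upd m (base + 32 * i + j) v).
Proof.
move=> Hj R j' i' Hj'; rewrite /upd /sset -R //.
case: eqP => E.
  have [-> ->] : j' = j /\ i' = i by lia.
  by rewrite !eqxx.
case: eqP => // E1; case: eqP => // E2; subst; by case: E.
Qed.

Lemma runs_dbl P pc m d k : d < base ->
  code_at P pc (nseq k (IAdd d d d)) ->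
  exists m', [/\ runs P pc m k (pc + k) m', seteq m m' d
               & m' d = 2 ^ k * m d].
Proof.
move=> Hd; elim: k pc m => [|k IH] pc m.
  by move=> _; exists m; split=> //; [rewrite addn0; exact: runs0|rewrite mul1n].
move=> /= /code_at_hd [H0 H1].
have [m' [R E V]] := IH _ (upd m d (m d + m d)) H1.
exists m'; split.
- rewrite addnS -addSn -[k.+1]add1n.
  by apply: runs_trans R => t; rewrite /= H0.
- by apply: seteq_trans E => //; apply: seteq_upd; lia.
- by rewrite V /upd eqxx expnS; lia.
Qed.

Lemma runs_addr P pc m j d : d.+1 < base -> code_at P pc (addr_code j d) ->
  exists m', [/\ runs P pc m 7 (pc + 7) m', seteq m m' d
               & m' d = base + 32 * m d + j].
Proof.
move=> Hd /code_at_cat [C]; rewrite size_nseq.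
move=> /code_at_hd [H1] /code_at_hd [H2] _.
have [m1 [R1 E1 V1]] := runs_dbl m (ltnW Hd) C.
exists (upd (upd m1 d.+1 (base + j)) d
     (upd m1 d.+1 (base + j) d + upd m1 d.+1 (base + j) d.+1)); split.
- have -> : pc + 7 = (pc + 5).+2 by lia.
  have -> : 7 = 5 + 2 by [].
  apply: runs_trans R1 _ => t /=.
  by rewrite H1 /= H2.
- apply: (seteq_trans (leqnn _) E1).
  apply: (@seteq_trans _ (upd m1 d.+1 (base + j)) _ d d) => //;
    apply: seteq_upd; lia.
- rewrite {1}/upd eqxx /upd eqxx.
  case: eqP => E; first by lia.
  by rewrite V1; lia.
Qed.

Opaque addr_code.

Lemma runs_ecode P e s d pc m : ewf e d -> represents s m ->
  code_at P pc (ecode e d) ->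
  exists m', [/\ runs P pc m (esize e) (pc + esize e) m', seteq m m' d
               & m' d = ev e s].
Proof.
have bin : forall (f : nat -> nat -> nat) (a b : expr) d m pc
   (I : nat -> nat -> nat -> instr),
  (forall P pc m r x y t, nth IHalt P pc = I r x y ->
     exec P t.+1 pc m = exec P t pc.+1 (upd m r (f (m x) (m y)))) ->
  (forall d pc m, ewf a d -> represents s m -> code_at P pc (ecode a d) ->
    exists m', [/\ runs P pc m (esize a) (pc + esize a) m', seteq m m' d
               & m' d = ev a s]) ->
  (forall d pc m, ewf b d -> represents s m -> code_at P pc (ecode b d) ->
    exists m', [/\ runs P pc m (esize b) (pc + esize b) m', seteq m m' d
               & m' d = ev b s]) ->
  ewf a d && ewf b d.+1 -> represents s m ->
  code_at P pc (ecode a d ++ ecode b d.+1 ++ [:: I d d d.+1]) ->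
  exists m', [/\ runs P pc m (esize a + esize b + 1)
                   (pc + (esize a + esize b + 1)) m', seteq m m' d
               & m' d = f (ev a s) (ev b s)].
  move=> f a b {}d {}m {}pc I HI IHa IHb /andP [Wa Wb] R.
  move=> /code_at_cat [Ca /code_at_cat [Cb]].
  rewrite !size_ecode => /code_at_hd [Hi _]; rewrite size_ecode in Cb.
  have [m1 [R1 E1 V1]] := IHa _ _ _ Wa R Ca.
  have [m2 [R2 E2 V2]] := IHb _ _ _ Wb (represents_seteq E1 R) Cb.
  exists (upd m2 d (f (m2 d) (m2 d.+1))); split.
  - apply: (runs_trans (runs_trans R1 R2)) => t.
    rewrite add1n (HI _ _ _ _ _ _ _ Hi).
    by rewrite !addnA addn1.
  - have := ewfS Wa => Hd; have := ewfS Wb => Hd'.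
    apply: (seteq_trans (leqnn _) E1).
    apply: (@seteq_trans _ m2 _ d d) => //; last by apply: seteq_upd; lia.
    by move=> r Hr; apply: E2; lia.
  - by rewrite /upd eqxx V2 E2 ?V1 // ltnSn.
elim: e d pc m => [c|j a IHa|a IHa b IHb|a IHa b IHb] d pc m /= W R.
- move=> /code_at_hd [H _]; exists (upd m d c); split.
  + by move=> t; rewrite add1n /= H addn1.
  + by apply: seteq_upd; lia.
  + by rewrite /upd eqxx.
- move=> /code_at_cat [Ca /code_at_cat [Cb]].
  rewrite size_ecode size_addr_code => /code_at_hd [Hi _].
  rewrite size_ecode in Cb.
  case/and3P: W => Wj Wa Wd.
  have [m1 [R1 E1 V1]] := IHa _ _ _ Wa R Ca.
  have [m2 [R2 E2 V2]] := runs_addr m1 Wd Cb.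
  have E := seteq_trans (leqnn _) E1 E2.
  exists (upd m2 d (m2 (m2 d))); split.
  + have -> : esize a + 8 = esize a + 7 + 1 by lia.
    apply: (runs_trans (runs_trans R1 R2)) => t.
    by rewrite add1n /= Hi !addnA addn1.
  + apply: (seteq_trans (leqnn _) E); apply: seteq_upd; lia.
  + by rewrite /upd eqxx V2 (represents_seteq E R) // V1.
- by apply: (bin addn) => // ? ? ? ? ? ? ? H; rewrite /= H.
- by apply: (bin subn) => // ? ? ? ? ? ? ? H; rewrite /= H.
Qed.

(** Commands write to the arrays, so only the temporaries below [d] can be preserved; among them are
    the counters of the enclosing loops. *)
Definition low_eq (m m' : memory) (d : nat) : Prop :=
  forall r, r < d -> m' r = m r.

Lemma seteq_low m m' d : seteq m m' d -> low_eq m m' d.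
Proof. by move=> H r Hr; apply: H; rewrite Hr. Qed.

Lemma runs_ccode P c s d pc m : cwf c d -> represents s m ->
  code_at P pc (ccode c d pc) ->
  exists t m', [/\ t <= cost c s, runs P pc m t (pc + csize c) m',
    represents (den c s) m' & low_eq m m' d].
Proof.
elim: c s d pc m => [|j a e|c1 IH1 c2 IH2|e c1 IH1 c2 IH2|x c IHc] s d pc m W R.
- by move=> _; exists 0, m; split=> //; rewrite addn0.
- case/and4P: W => Wj Wa We Wd.
  move=> /code_at_cat [Ca /code_at_cat [Cb /code_at_cat [Cc]]].
  rewrite !size_ecode size_addr_code in Cb Cc *; move=> /code_at_hd [Hi _].
  have [m1 [R1 E1 V1]] := runs_ecode Wa R Ca.
  have [m2 [R2 E2 V2]] := runs_addr m1 Wd Cb.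
  have E := seteq_trans (leqnn _) E1 E2.
  have [m3 [R3 E3 V3]] := runs_ecode We (represents_seteq E R) Cc.
  have V4 : m3 d = base + 32 * ev a s + j by rewrite E3 ?ltnSn // V2 V1.
  exists (esize a + 7 + esize e + 1), (upd m3 (m3 d) (m3 d.+1)); split.
  + by rewrite /=; lia.
  + have -> : pc + csize (Put j a e) = (pc + esize a + 7 + esize e).+1.
      by rewrite /=; lia.
    apply: (runs_trans (runs_trans (runs_trans R1 R2) R3)) => t.
    by rewrite add1n /= Hi.
  + rewrite V4 V3 /=; apply: represents_upd => //.
    exact: (represents_seteq E3 (represents_seteq E R)).
  + move=> r Hr; rewrite V4 /upd; case: eqP => [Er|_]; first by lia.
    by rewrite E3 ?E //; lia.
- case/andP: W => W1 W2 /code_at_cat [C1]; rewrite size_ccode => C2.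
  have [t1 [m1 [T1 R1 S1 L1]]] := IH1 _ _ _ _ W1 R C1.
  have [t2 [m2 [T2 R2 S2 L2]]] := IH2 _ _ _ _ W2 S1 C2.
  exists (t1 + t2), m2; split=> //=; first exact: leq_add.
  + by rewrite addnA; apply: runs_trans R1 R2.
  + by move=> r Hr; rewrite L2 ?L1.
- case/and3P: W => We W1 W2.
  move=> /code_at_cat [Ce]; rewrite size_ecode.
  move=> /(@code_at_cat _ _ [:: _]) [/code_at_hd [Hz _]] /=.
  move=> /code_at_cat [C1]; rewrite size_ccode.
  move=> /(@code_at_cat _ _ [:: _]) [/code_at_hd [Hj _]] /= C2.
  have [m1 [R1 E1 V1]] := runs_ecode We R Ce.
  have S1 := represents_seteq E1 R; have L1 := seteq_low E1.
  case: (ev e s =P 0) => Ee /=.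
  + have -> : pc + (esize e + csize c1 + csize c2 + 2) =
              pc + esize e + csize c1 + 2 + csize c2 by lia.
    have C2' : code_at P (pc + esize e + csize c1 + 2)
        (ccode c2 d (pc + esize e + csize c1 + 2)).
      by move: C2; congr (code_at _ _ _); lia.
    have [t2 [m2 [T2 R2 S2 L2]]] := IH2 _ _ _ _ W2 S1 C2'.
    exists (esize e + 1 + t2), m2; split=> //=; try lia.
    * apply: runs_trans R2; apply: (runs_trans R1) => t.
      by rewrite add1n /= Hz V1 Ee.
    * by move=> r Hr; rewrite L2 ?L1.
  + have [t2 [m2 [T2 R2 S2 L2]]] := IH1 _ _ _ _ W1 S1 C1.
    exists (esize e + 1 + t2 + 1), m2; split=> //=; try lia.
    * apply: (@runs_trans _ _ _ _ (pc + esize e + 1 + csize c1) m2).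
        apply: runs_trans R2; apply: (runs_trans R1) => t.
        by rewrite add1n /= Hz V1; case: eqP Ee => // _ _; rewrite addn1.
      by move=> t; rewrite add1n /= Hj.
    * by move=> r Hr; rewrite L2 ?L1.
- case/and3P: W => Wx Wd Wc.
  move=> /(@code_at_cat _ _ (ecode (Get x (Cst 0)) d)) [Ce]; rewrite size_ecode.
  move=> /(@code_at_cat _ _ [:: _]) [/code_at_hd [Hz _]].
  move=> /code_at_cat [Cb]; rewrite size_ccode.
  move=> /code_at_hd [H1] /code_at_hd [H2] /code_at_hd [H3] _.
  have We : ewf (Get x (Cst 0)) d by rewrite /= Wx Wd andbT (ltnW Wd).
  have [m1 [R1 E1 V1]] := runs_ecode We R Ce.
  have S1 := represents_seteq E1 R; have L1 := seteq_low E1.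
  rewrite [esize _]/= in Hz Cb H1 H2 H3 R1.
  rewrite [ev _ _]/= in V1.
  have {}Cb : code_at P (pc + 10) (ccode c d.+1 (pc + 10)).
    by move: Cb; rewrite /=; congr (code_at _ _ _); lia.
  (* Generalised to a state in which [i] iterations are done and [n] remain, since the cost of an
     iteration depends on the store it meets. *)
  have loop : forall n i m1, represents (iter i (den c) s) m1 -> m1 d = n ->
     exists t m', [/\ t <= \sum_(i <= k < i + n)
        (cost c (iter k (den c) s) + 4) + 1,
        runs P (pc + 9) m1 t (pc + csize (For x c)) m',
        represents (iter (i + n) (den c) s) m' & low_eq m1 m' d].
    elim=> [|n IHn] i {V1 E1 R1 S1 L1}m1 S1 V1.
      exists 1, m1; split=> //; first by rewrite addn1.
        by move=> t; rewrite add1n /= Hz V1.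
      by rewrite addn0.
    have [t2 [m2 [T2 R2 S2 L2]]] := IHc _ _ _ _ Wc S1 Cb.
    pose m2' := upd m2 d.+1 1; pose m3 := upd m2' d (m2' d - m2' d.+1).
    have S3 : represents (iter i.+1 (den c) s) m3.
      apply: (@represents_seteq _ m2 _ d) => //.
      apply: (@seteq_trans _ m2' _ d d) => //;
        apply: seteq_upd; lia.
    have V3 : m3 d = n.
      rewrite /m3 {1}/upd eqxx /m2' /upd eqxx L2 // V1.
      by case: eqP => [E|_]; lia.
    have [t4 [m4 [T4 R4 S4 L4]]] := IHn i.+1 _ S3 V3.
    exists (1 + t2 + 3 + t4), m4; split.
    + rewrite big_ltn; last by lia.
      by move: T4; rewrite addSnnS; move: (\sum_(_ <= _ < _) _) => *; lia.
    + apply: runs_trans R4.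
      apply: (@runs_trans _ _ _ _ (pc + 10 + csize c) m2).
        apply: runs_trans R2 => t.
        by rewrite add1n /= Hz V1 /=; congr exec; lia.
      move=> t; rewrite !addSn add0n /=.
      have -> : pc + 10 + csize c = pc + 9 + 1 + csize c by lia.
      by move: H1 H2 H3 => /= -> /= -> /= -> /=.
    + by move: S4; rewrite addSnnS.
    + move=> r Hr; rewrite L4 // /m3 {1}/upd ifN; last by lia.
      by rewrite /m2' /upd ifN ?L2; lia.
  have [t2 [m2 [T2 R2 S2 L2]]] := loop _ 0 _ S1 V1.
  exists (9 + t2), m2; split.
  + move: T2; rewrite add0n big_mkord /=.
    by move: (\sum_(_ < _) _) => *; lia.
  + exact: runs_trans R1 R2.
  + by move: S2; rewrite add0n.
  + by move=> r Hr; rewrite L2 ?L1.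
Qed.

(** * Moving the input out of the working registers *)

Lemma exec_mono P t t' pc m m' :
  t <= t' -> exec P t pc m = Some m' -> exec P t' pc m = Some m'.
Proof.
elim: t t' pc m => [|t IH] [|t'] pc m //= Ht.
case: (nth IHalt P pc) => // *; exact: IH.
Qed.

(** The last three instructions fetch the result into register 0, where outputs are read. The fuel
    [X] is arbitrary above the cost because the theorem prescribes it. *)
Lemma exec_ccode pre c r X pc0 m0 (s : store) m t :
  let P := pre ++ ccode c 0 (size pre)
           ++ [:: IConst 0 (base + r); ILoad 0 0; IHalt] in
  cwf c 0 -> r < 32 -> runs P pc0 m0 t (size pre) m -> represents s m ->
  t + cost c s + 3 <= X ->
  exists m', exec P X pc0 m0 = Some m' /\ m' 0 = den c s r 0.
Proof.
move=> P W Hr R S HX.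
have [t1 [m1 [T1 R1 S1 _]]] := 
  runs_ccode W S (@code_at_mid pre _
    [:: IConst 0 (base + r); ILoad 0 0; IHalt]).
have Hepi : code_at P (size pre + csize c)
    [:: IConst 0 (base + r); ILoad 0 0; IHalt].
  move=> i Hi; rewrite /P catA nth_cat size_cat size_ccode.
  by rewrite ltnNge leq_addr /= addKn.
move: Hepi => /code_at_hd [H1 /code_at_hd [H2 /code_at_hd [H3 _]]].
exists (upd (upd m1 0 (base + r)) 0 (den c s r 0)); split; last first.
  by rewrite /upd eqxx.
apply: (@exec_mono _ (t + t1 + 3)); first by lia.
rewrite (runs_trans R R1) /= H1 /= H2 /= H3; congr (Some (upd _ _ _)).
by rewrite -(S1 r 0) // muln0 addn0.
Qed.

(* The input occupies the low addresses, so there are no free registers at the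
   start, except address 3: it holds the diagonal entry [e 0 0 = 0].  The bits
   at addresses 4 to 11 are first packed into it, which frees these registers
   for copying the rest of the input to array 0, in descending order.  Entries
   that are not bits (from [d] on, when [n] is tiny) are irrelevant. *)
Definition pack_code (pc i : nat) : program :=
  [:: IJz i (pc + 2); IConst i 1; IAdd 3 3 3; IAdd 3 3 i].

Lemma runs_const P pc m r c : nth IHalt P pc = IConst r c ->
  runs P pc m 1 pc.+1 (upd m r c).
Proof. by move=> H t; rewrite /= H. Qed.

Lemma runs_add P pc m r a b : nth IHalt P pc = IAdd r a b ->
  runs P pc m 1 pc.+1 (upd m r (m a + m b)).
Proof. by move=> H t; rewrite /= H. Qed.

Lemma runs_sub P pc m r a b : nth IHalt P pc = ISub r a b ->
  runs P pc m 1 pc.+1 (upd m r (m a - m b)).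
Proof. by move=> H t; rewrite /= H. Qed.

Lemma runs_load P pc m r a : nth IHalt P pc = ILoad r a ->
  runs P pc m 1 pc.+1 (upd m r (m (m a))).
Proof. by move=> H t; rewrite /= H. Qed.

Lemma runs_store P pc m r a : nth IHalt P pc = IStore a r ->
  runs P pc m 1 pc.+1 (upd m (m a) (m r)).
Proof. by move=> H t; rewrite /= H. Qed.

Lemma runs_jz P pc m r tg : nth IHalt P pc = IJz r tg ->
  runs P pc m 1 (if m r == 0 then tg else pc.+1) m.
Proof. by move=> H t; rewrite /= H. Qed.

Lemma runs_jmp P pc m tg : nth IHalt P pc = IJmp tg -> runs P pc m 1 tg m.
Proof. by move=> H t; rewrite /= H. Qed.

(** After the packing, register 4 receives [n * (n + 2) + 3], the number of cells taken by the
    header, the matrix, [S] and [T], and the copy loop runs downwards from there. The final stores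
    set cells 0 to 3 of array 0, the last one carrying the packed bits. *)
Definition prologue : program :=
  flatten [seq pack_code (4 * (11 - i)) i | i <- [:: 11; 10; 9; 8; 7; 6; 5; 4]]
  ++ [:: IConst 5 1; IConst 4 3; IConst 6 0; IAdd 6 6 0; IConst 7 2; IAdd 7 7 0;
         IJz 6 42; IAdd 4 4 7; ISub 6 6 5; IJmp 38;
         IJz 4 56; ISub 4 4 5; IConst 6 0; IAdd 6 6 4]
  ++ addr_code 0 6
  ++ [:: ILoad 8 4; IStore 6 8; IJmp 42;
         IConst 6 12; IStore 6 0; IConst 6 44; IStore 6 1;
         IConst 6 76; IStore 6 2; IConst 6 108; IStore 6 3].

(** Horner evaluation: the last address in the list contributes the lowest bit. *)
Definition packed (m : memory) (rs : seq nat) : nat :=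
  foldl (fun v i => (m i != 0) + 2 * v) 0 rs.

Lemma runs_pack P pc i m : 3 < i -> code_at P pc (pack_code pc i) ->
  exists t m', [/\ t <= 4, runs P pc m t (pc + 4) m',
    m' 3 = (m i != 0) + 2 * m 3,
    forall r, r != 3 -> r != i -> m' r = m r
    & forall r, r != 3 -> (m' r != 0) = (m r != 0)].
Proof.
move=> Hi /code_at_hd [H1 /code_at_hd [H2 /code_at_hd [H3 /code_at_hd [H4 _]]]].
pose fin m1 := upd (upd m1 3 (m1 3 + m1 3)) 3
  (upd m1 3 (m1 3 + m1 3) 3 + upd m1 3 (m1 3 + m1 3) i).
have F m1 : [/\ fin m1 3 = m1 i + 2 * m1 3
    & forall r, r != 3 -> fin m1 r = m1 r].
  rewrite /fin /upd; split; last by move=> r /negbTE ->.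
  by rewrite eqxx; case: eqP => E; lia.
case: (m i =P 0) => E.
  exists 3, (fin m); have [F1 F2] := F m; split=> //.
  - by move=> t; rewrite /= H1 E /= addn2 H3 /= H4 addn4.
  - by rewrite F1 E.
  - by move=> r Hr _; exact: F2.
  - by move=> r Hr; rewrite F2.
exists 4, (fin (upd m i 1)); have [F1 F2] := F (upd m i 1); split=> //.
- move=> t; rewrite /= H1 /=; case: eqP => // _.
  by rewrite H2 /= H3 /= H4 addn4.
- by rewrite F1 /upd eqxx; case: eqP => [|_] //; lia.
- by move=> r Hr /negbTE Hri; rewrite F2 // /upd Hri.
- by move=> r Hr; rewrite F2 // /upd; case: (r =P i) => // ->; move/eqP: E => ->.
Qed.

Lemma runs_packs P pc rs m : all (leq 4) rs -> m 3 = 0 ->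
  (forall k, k < size rs -> code_at P (pc + 4 * k)
      (pack_code (pc + 4 * k) (nth 0 rs k))) ->
  exists t m', [/\ t <= 4 * size rs, runs P pc m t (pc + 4 * size rs) m',
    m' 3 = packed m rs & forall r, r != 3 -> r \notin rs -> m' r = m r].
Proof.
move=> A Z C.
(* [pack_code] replaces a nonzero entry by 1, so the induction also needs that zero tests are
   stable. *)
suff: exists t m', [/\ t <= 4 * size rs, runs P pc m t (pc + 4 * size rs) m',
    m' 3 = packed m rs, forall r, r != 3 -> r \notin rs -> m' r = m r
    & forall r, r != 3 -> (m' r != 0) = (m r != 0)].
  by case=> t [m' [? ? ? ? _]]; exists t, m'.
elim/last_ind: rs A C => [|rs i IH] A C.
  by exists 0, m; split=> //; rewrite muln0 addn0.
move: A; rewrite all_rcons => /andP [Hi A].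
have [k Hk|t [m1 [T1 R1 V1 U1 N1]]] := IH A.
  have := C k; rewrite size_rcons nth_rcons Hk ltnS ltnW //; exact.
have C2 := C (size rs); rewrite size_rcons nth_rcons ltnn eqxx ltnSn in C2.
have [t2 [m2 [T2 R2 V2 U2 N2]]] := runs_pack m1 Hi (C2 isT).
exists (t + t2), m2; split.
- by rewrite size_rcons; lia.
- have -> : pc + 4 * size (rcons rs i) = pc + 4 * size rs + 4.
    by rewrite size_rcons; lia.
  exact: runs_trans R1 R2.
- by rewrite V2 V1 /packed -cats1 foldl_cat /= N1 //; lia.
- move=> r Hr; rewrite mem_rcons inE negb_or => /andP [H1 H2].
  by rewrite U2 // U1.
- by move=> r Hr; rewrite N2 // N1.
Qed.

Section Prologue.
Variable rest : program.
Let P := prologue ++ rest.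

(** Multiplication by repeated addition, with register 6 as the counter. *)
Lemma runs_size v m : m 6 = v -> m 5 = 1 ->
  exists m', [/\ runs P 38 m (4 * v + 1) 42 m', m' 4 = m 4 + v * m 7
    & forall r, r != 4 -> r != 6 -> m' r = m r].
Proof.
elim: v m => [|v IH] m H6 H5.
  exists m; split=> [t||//]; first by rewrite /= H6.
  by rewrite mul0n addn0.
pose m1 := upd (upd m 4 (m 4 + m 7)) 6 v.
have [m2 [R2 V2 U2]] := IH m1 erefl H5.
exists m2; split.
- have -> : 4 * v.+1 + 1 = 4 + (4 * v + 1) by lia.
  apply: runs_trans R2 => t; rewrite /= H6 /=.
  congr exec; rewrite /m1; congr upd; rewrite /upd /= H6 H5; lia.
- by rewrite V2 /m1 /upd /=; lia.
- by move=> r H4 H7; rewrite U2 // /m1 /upd (negbTE H4) (negbTE H7).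
Qed.

Lemma code_addr : code_at P 46 (addr_code 0 6).
Proof.
exact: (@code_at_mid
  (flatten [seq pack_code (4 * (11 - i)) i | i <- [:: 11; 10; 9; 8; 7; 6; 5; 4]]
  ++ [:: IConst 5 1; IConst 4 3; IConst 6 0; IAdd 6 6 0; IConst 7 2; IAdd 7 7 0;
         IJz 6 42; IAdd 4 4 7; ISub 6 6 5; IJmp 38;
         IJz 4 56; ISub 4 4 5; IConst 6 0; IAdd 6 6 4])
  (addr_code 0 6)
  ([:: ILoad 8 4; IStore 6 8; IJmp 42;
         IConst 6 12; IStore 6 0; IConst 6 44; IStore 6 1;
         IConst 6 76; IStore 6 2; IConst 6 108; IStore 6 3] ++ rest)).
Qed.

(** Cell [i] goes to address [base + 32 * i], which lies above [i]; in descending order a store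
    therefore only overwrites sources that have already been copied. The last clause protects the
    copies made so far during the induction. *)
Lemma runs_copy v m : m 4 = v -> m 5 = 1 ->
  exists m', [/\ runs P 42 m (14 * v + 1) 56 m',
    forall i, base <= i < v -> m' (base + 32 * i) = m i,
    forall r, r < 4 -> m' r = m r
    & forall a, base + 32 * v <= a -> m' a = m a].
Proof.
elim: v m => [|v IH] m H4 H5.
  exists m; split=> //; last by move=> i; lia.
  by have := @runs_jz P 42 m 4 56 erefl; rewrite H4.
have := @runs_jz P 42 m 4 56 erefl; rewrite H4 /= => R1.
have R2 := runs_trans R1 (@runs_sub P 43 m 4 4 5 erefl).
rewrite H4 H5 subn1 /= in R2.
set m2 := upd m 4 v in R2.
have R3 := runs_trans R2 (@runs_const P 44 m2 6 0 erefl).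
set m3 := upd m2 6 0 in R3.
have R4 := runs_trans R3 (@runs_add P 45 m3 6 6 4 erefl).
set m4 := upd _ _ _ in R4.
have [m5 [R5 E5 V5]] := runs_addr m4 (isT : 7 < base) code_addr.
have V4 : m4 4 = v by [].
have V6 : m4 6 = v by [].
have V54 : m5 4 = v by rewrite E5.
rewrite V6 addn0 in V5.
have R6 := runs_trans (runs_trans R4 R5) (@runs_load P 53 m5 8 4 erefl).
rewrite V54 in R6; set m6 := upd _ _ _ in R6.
have R7 := runs_trans R6 (@runs_store P 54 m6 8 6 erefl).
have V66 : m6 6 = base + 32 * v by [].
have V68 : m6 8 = m5 v by [].
rewrite V66 V68 in R7; set m7 := upd m6 _ _ in R7.
have R8 := runs_trans R7 (@runs_jmp P 55 m7 42 erefl).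
have far a : base <= a -> a != base + 32 * v -> m7 a = m a.
  move=> Ha /negbTE Ea; rewrite /m7 /upd Ea /m6 /upd ifN; last by lia.
  rewrite E5 ?Ha ?orbT // /m4 /m3 /m2 /upd !ifN //; lia.
have low a : a < 6 -> m7 a = m2 a.
  move=> Ha; rewrite /m7 /upd ifN; last by lia.
  rewrite /m6 /upd ifN; last by lia.
  rewrite E5 ?Ha // /m4 /m3 /upd !ifN //; lia.
have [||m8 [R9 V9 U9 A9]] := IH m7; try by rewrite low.
exists m8; split.
- have -> : 14 * v.+1 + 1 = 1 + 1 + 1 + 1 + 7 + 1 + 1 + 1 + (14 * v + 1) by lia.
  exact: runs_trans R8 R9.
- move=> i Hi; case: (ltnP i v) => Hiv; first by rewrite V9 ?far //; lia.
  have -> : i = v by lia.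
  rewrite A9 // /m7 /upd eqxx E5; last by lia.
  rewrite /m4 /m3 /m2 /upd !ifN //; lia.
- move=> r Hr; rewrite U9 // low; last by lia.
  by rewrite /m2 /upd ifN //; lia.
- by move=> a Ha; rewrite A9 ?far //; lia.
Qed.

Lemma runs_prologue inp (n := nth 0 inp 0) : nth 0 inp 3 = 0 ->
  exists t m, [/\ t <= 100 * n.+1 ^ 2, runs P 0 (init inp) t 64 m,
    forall i, base <= i < n * (n + 2) + 3 -> m (base + 32 * i) = nth 0 inp i,
    forall r, r < 3 -> m (base + 32 * r) = nth 0 inp r
    & m (base + 32 * 3) = packed (init inp) [:: 11; 10; 9; 8; 7; 6; 5; 4]].
Proof.
move=> H3.
have C k : k < 8 -> code_at P (0 + 4 * k) (pack_code (0 + 4 * k)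
    (nth 0 [:: 11; 10; 9; 8; 7; 6; 5; 4] k)).
  by case: k => [|[|[|[|[|[|[|[|k]]]]]]]] // _ [|[|[|[|i]]]].
have [t0 [m0 [T0 R0 V0 U0]]] := 
  @runs_packs P 0 [:: 11; 10; 9; 8; 7; 6; 5; 4] _ isT (H3 : init inp 3 = 0) C.
have {}U0 r : (r < 3) || (base <= r) -> m0 r = nth 0 inp r.
  by move=> Hr; apply: U0; rewrite ?inE ?negb_or; lia.
pose m1 := upd (upd m0 5 1) 4 3.
have R1 := runs_trans R0 (runs_trans (@runs_const P 32 m0 5 1 erefl)
             (@runs_const P 33 _ 4 3 erefl)).
rewrite -/m1 in R1.
pose m2 := upd (upd m1 6 0) 6 n.
have E2 : upd (upd m1 6 0) 6 (upd m1 6 0 6 + upd m1 6 0 0) = m2.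
  by congr upd; rewrite /m1 /upd /= U0.
have R2 := runs_trans R1 (runs_trans (@runs_const P 34 m1 6 0 erefl)
             (@runs_add P 35 _ 6 6 0 erefl)).
rewrite E2 in R2.
pose m3 := upd (upd m2 7 2) 7 (2 + n).
have E3 : upd (upd m2 7 2) 7 (upd m2 7 2 7 + upd m2 7 2 0) = m3.
  by congr upd; rewrite /m2 /m1 /upd /= ?U0.
have R3 := runs_trans R2 (runs_trans (@runs_const P 36 m2 7 2 erefl)
             (@runs_add P 37 _ 7 7 0 erefl)).
rewrite E3 in R3.
have [m4 [R4 V4 U4]] := @runs_size n m3 erefl erefl.
have {}V4 : m4 4 = n * (n + 2) + 3 by rewrite V4 -[m3 4]/3 -[m3 7]/(2 + n); lia.
have V45 : m4 5 = 1 by rewrite U4.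
have [m5 [R5 V5 U5 _]] := runs_copy V4 V45.
have U34 r : r < 4 -> m5 r = m0 r.
  move=> Hr; rewrite U5 // U4; try lia.
  by rewrite /m3 /m2 /m1 /upd !ifN //; lia.
have F r : base <= r -> m4 r = nth 0 inp r.
  move=> Hr; rewrite U4; try lia.
  by rewrite /m3 /m2 /m1 /upd !ifN ?U0 ?Hr ?orbT //; lia.
pose w m r := upd (upd m 6 (base + 32 * r)) (base + 32 * r) (m r).
have W m pc r : r < 4 -> nth IHalt P pc = IConst 6 (base + 32 * r) ->
    nth IHalt P pc.+1 = IStore 6 r -> runs P pc m 2 pc.+2 (w m r).
  move=> Hr P1 P2.
  have -> : w m r = upd (upd m 6 (base + 32 * r))
     (upd m 6 (base + 32 * r) 6) (upd m 6 (base + 32 * r) r).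
    by rewrite /w; congr (upd _ _ _); rewrite /upd ifN //; lia.
  exact: (runs_trans (runs_const m P1) (runs_store _ P2)).
exists (t0 + 2 + 2 + 2 + (4 * n + 1) + (14 * (n * (n + 2) + 3) + 1) + 2 + 2 + 2 + 2),
  (w (w (w (w m5 0) 1) 2) 3); split.
- by move: T0 => /=; rewrite -/n; lia.
- apply: runs_trans (W _ 62 3 isT erefl erefl).
  apply: runs_trans (W _ 60 2 isT erefl erefl).
  apply: runs_trans (W _ 58 1 isT erefl erefl).
  apply: runs_trans (W _ 56 0 isT erefl erefl).
  exact: (runs_trans (runs_trans R3 R4) R5).
- move=> i Hi; rewrite -F ?V5 //; last by lia.
  by rewrite /w /upd !ifN ?V5 //; lia.
- by case=> [|[|[|//]]] _; rewrite /w /upd /= U34 // U0.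
- by rewrite /w /upd /= U34 // V0.
Qed.

End Prologue.

(** * Frame and cost of structured programs *)

Fixpoint mods (c : com) : seq nat :=
  match c with
  | Skip => [::]
  | Put j _ _ => [:: j]
  | Seq c1 c2 | If _ c1 c2 => mods c1 ++ mods c2
  | For _ c => mods c
  end.

Fixpoint loop_vars (c : com) : seq nat :=
  match c with
  | Skip | Put _ _ _ => [::]
  | Seq c1 c2 | If _ c1 c2 => loop_vars c1 ++ loop_vars c2
  | For x c => x :: loop_vars c
  end.

Lemma frame c s j : j \notin mods c -> den c s j = s j.
Proof.
elim: c s => [|j0 a e|c1 IH1 c2 IH2|e c1 IH1 c2 IH2|x c IHc] s //=.
- by rewrite inE /sset => /negbTE ->.
- by rewrite mem_cat negb_or => /andP [H1 H2]; rewrite IH2 // IH1.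
- by rewrite mem_cat negb_or => /andP [H1 H2]; case: ifP; rewrite ?IH1 ?IH2.
- by move=> H; elim: (s x 0) => //= n IH; rewrite IHc.
Qed.

Fixpoint coef (c : com) : nat :=
  match c with
  | Skip => 0
  | Put _ a e => esize a + esize e + 8
  | Seq c1 c2 => coef c1 + coef c2
  | If e c1 c2 => esize e + 2 + coef c1 + coef c2
  | For _ c => coef c + 14
  end.

Fixpoint deg (c : com) : nat :=
  match c with
  | Skip | Put _ _ _ => 0
  | Seq c1 c2 | If _ c1 c2 => maxn (deg c1) (deg c2)
  | For _ c => (deg c).+1
  end.

(** A loop bound that the program never modifies keeps its initial value, so every loop makes at
    most [Z] iterations and the loop depth is the degree of the cost. *)
Lemma cost_bound c s Z : 0 < Z ->
  all (fun x => x \notin mods c) (loop_vars c) ->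
  (forall x, x \in loop_vars c -> s x 0 <= Z) ->
  cost c s <= coef c * Z ^ deg c.
Proof.
move=> Z0.
(* The loop bounds of a subcommand must survive the whole command, so the induction fixes a superset
   [M] of the modified arrays. *)
suff main : forall M : seq nat, {subset mods c <= M} ->
    (forall x, x \in loop_vars c -> x \notin M) ->
    (forall x, x \in loop_vars c -> s x 0 <= Z) -> cost c s <= coef c * Z ^ deg c.
  by move=> /allP A B; apply: (main (mods c)).
move=> M; have Zm a b : Z ^ a <= Z ^ maxn a b by rewrite leq_pexp2l // leq_maxl.
have Zm' a b : Z ^ b <= Z ^ maxn a b by rewrite leq_pexp2l // leq_maxr.
elim: c s => [|j0 a e|c1 IH1 c2 IH2|e c1 IH1 c2 IH2|x c IHc] s //= sM lM lZ.
- by rewrite muln1.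
- have {}IH1 : cost c1 s <= coef c1 * Z ^ deg c1.
    by apply: IH1 => x Hx; [apply: sM|apply: lM|apply: lZ]; rewrite mem_cat Hx.
  have {}IH2 : cost c2 (den c1 s) <= coef c2 * Z ^ deg c2.
    apply: IH2 => x Hx; first by apply: sM; rewrite mem_cat Hx orbT.
      by apply: lM; rewrite mem_cat Hx orbT.
    rewrite frame; first by apply: lZ; rewrite mem_cat Hx orbT.
    have := lM x; rewrite mem_cat Hx orbT => /(_ isT).
    by apply: contra => h; apply: sM; rewrite mem_cat h.
  rewrite mulnDl leq_add //.
    by apply: (leq_trans IH1); rewrite leq_mul2l Zm orbT.
  by apply: (leq_trans IH2); rewrite leq_mul2l Zm' orbT.
- have {}IH1 : cost c1 s <= coef c1 * Z ^ deg c1.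
    by apply: IH1 => x Hx; [apply: sM|apply: lM|apply: lZ]; rewrite mem_cat Hx.
  have {}IH2 : cost c2 s <= coef c2 * Z ^ deg c2.
    by apply: IH2 => x Hx; [apply: sM|apply: lM|apply: lZ]; rewrite mem_cat Hx orbT.
  have H1 : cost c1 s <= coef c1 * Z ^ maxn (deg c1) (deg c2).
    by apply: (leq_trans IH1); rewrite leq_mul2l Zm orbT.
  have H2 : cost c2 s <= coef c2 * Z ^ maxn (deg c1) (deg c2).
    by apply: (leq_trans IH2); rewrite leq_mul2l Zm' orbT.
  have Zp : 0 < Z ^ maxn (deg c1) (deg c2) by rewrite expn_gt0 Z0.
  by rewrite !mulnDl; move: H1 H2 Zp; case: ifP => _;
    move: (_ ^ _) (coef c1) (coef c2) => z a b *; nia.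
- have Hx : s x 0 <= Z by apply: lZ; rewrite inE eqxx.
  have H i : cost c (iter i (den c) s) <= coef c * Z ^ deg c.
    apply: IHc => // y Hy; first by apply: lM; rewrite inE Hy orbT.
    have <- : s y 0 = iter i (den c) s y 0.
      elim: i => //= i ->; rewrite frame //.
      by have := lM y; rewrite inE Hy orbT => /(_ isT); apply: contra; apply: sM.
    by apply: lZ; rewrite inE Hy orbT.
  have : \sum_(i < s x 0) (cost c (iter i (den c) s) + 4)
      <= s x 0 * (coef c * Z ^ deg c + 4).
    rewrite -[X in X * _]card_ord -sum_nat_const leq_sum // => i _.
    by rewrite leq_add2r.
  have Zp : 0 < Z ^ deg c by rewrite expn_gt0 Z0.
  rewrite expnS; move: (\sum_(_ < _) _) (_ ^ _) (coef c) Zp Hx => S z a; nia.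
Qed.

(** * The search *)

Lemma iota_rcons i : iota 0 i.+1 = rcons (iota 0 i) i.
Proof. by rewrite -addn1 iotaD cats1. Qed.

Section Search.
Variables (n k K : nat) (S T : nat -> bool) (E : nat -> nat -> bool).

(* [y q = n] (or more) means that the variable [q] is unassigned. *)
Definition compat (nxt y : nat -> nat) (p v q : nat) : bool :=
  [&& y q < n, q < nxt p & p < nxt q] ==> (y q != v) && ~~ E (y q) v.

Definition cand (nxt y : nat -> nat) (p v : nat) : bool :=
  [&& (p < k) ==> S v, (K <= nxt p) ==> T v
    & all (compat nxt y p v) (iota 0 K)].

Definition cands (nxt y : nat -> nat) (p : nat) : seq nat :=
  filter (cand nxt y p) (iota 0 n).

(** The triple consists of a variable, the length of its list and the entry at position [g]. The
    initial length [n.+1] exceeds every list; the value [n] signals failure, both when no variable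
    is left and when [g] lies beyond the list. *)
Fixpoint best (nxt y : nat -> nat) (g i : nat) : nat * nat * nat :=
  match i with
  | 0 => (K, n.+1, n)
  | i'.+1 =>
    let c := cands nxt y i' in
    let r := best nxt y g i' in
    if (n <= y i') && (size c < r.1.2) then (i', size c, nth n c g) else r
  end.

(* [nxt p] is the variable that replaces [p], or [K] if [p] is final. *)
Definition plan_step (st : nat * (nat -> nat) * bool) (g : nat) :=
  let: (p, nxt, fail) := st in
  if fail then (p.+1, nxt, fail)
  else if (g < p) && (K <= nxt g) then (p.+1, upd nxt g p, false)
  else (p.+1, nxt, true).

Definition round (B : nat) (nxt : nat -> nat) (st : (nat -> nat) * bool * bool)
    (g : nat) :=
  let: (y, fail, tr) := st in
  if fail then st
  else
    let: (b, c, v) := best nxt y g K in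
    (if v < n then upd y b v else y, n <= v, tr || (B < c)).

Definition plan (nxt0 : nat -> nat) (ds : seq nat) :=
  foldl plan_step (k, nxt0, false) ds.

Definition sim (B : nat) (nxt0 y0 : nat -> nat) (ds1 ds2 : seq nat) :=
  let st := plan nxt0 ds1 in
  foldl (round B st.1.2) (y0, st.2, false) ds2.

End Search.

Definition digit (B j W : nat) : nat := W %/ B ^ j %% B.

Definition digits (B o L W : nat) : seq nat :=
  [seq digit B (o + j) W | j <- iota 0 L].

(** * The search program *)

(* Arrays: [vIN] input, [vROW x] start of row [x] of the adjacency matrix in
   [vIN] (rows [n] and [n + 1] are [S] and [T]), [vNXT] the plan, [vY] the
   partial assignment, where [n] stands for an unassigned variable.  Scalars:
   [vU] the digits still to be read from the branch number [vW], [vG] the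
   current digit, [vCNT] the number of branches, [vTR] truncation flag. *)
Notation vIN := 0 (only parsing).
Notation vN := 1 (only parsing).
Notation vKK := 2 (only parsing).
Notation vL := 3 (only parsing).
Notation vK := 4 (only parsing).
Notation vROW := 5 (only parsing).
Notation vB := 6 (only parsing).
Notation vCNT := 7 (only parsing).
Notation vTR := 8 (only parsing).
Notation vFAIL := 9 (only parsing).
Notation vU := 10 (only parsing).
Notation vG := 11 (only parsing).
Notation vNXT := 12 (only parsing).
Notation vY := 13 (only parsing).
Notation vP := 14 (only parsing).
Notation vQ := 15 (only parsing).
Notation vV := 16 (only parsing).
Notation vOK := 17 (only parsing).
Notation vCN := 18 (only parsing).
Notation vVAL := 19 (only parsing).
Notation vBEST := 20 (only parsing).
Notation vBC := 21 (only parsing).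
Notation vBVAL := 22 (only parsing).
Notation vDONE := 23 (only parsing).
Notation vRES := 24 (only parsing).
Notation vW := 25 (only parsing).
Notation vT := 26 (only parsing).
Notation vI := 27 (only parsing).
Notation vLN := 28 (only parsing).
Notation vM := 29 (only parsing).

Definition var (x : nat) : expr := Get x (Cst 0).
Definition asg (x : nat) (e : expr) : com := Put x (Cst 0) e.
Definition incr (x : nat) : com := asg x (Plus (var x) (Cst 1)).
Infix ";;" := Seq (at level 70, right associativity).

Definition divmod_body : com :=
  If (Minus (Plus (var vU) (Cst 1)) (var vB))
    (asg vU (Minus (var vU) (var vB)) ;; incr vQ) Skip.

(** Division by repeated subtraction: the remainder, which is the next digit, goes to [vG], and the
    quotient stays in [vU]. The scalar [x] need only bound the quotient, as the loop idles once no
    subtraction is possible. *)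
Definition divmod (x : nat) : com :=
  asg vQ (Cst 0) ;; For x divmod_body ;;
  asg vG (var vU) ;; asg vU (var vQ).

(** Conditions are coded by truncated subtraction: [Minus a b] is nonzero iff [b < a], and the sum
    of the two differences is nonzero iff [a != b]. *)
Definition source_test : com :=
  If (Minus (var vKK) (var vP))
    (If (Get vIN (Plus (Get vROW (var vN)) (var vV))) Skip (asg vOK (Cst 0)))
    Skip.

Definition target_test : com :=
  If (Minus (var vK) (Get vNXT (var vP))) Skip
    (If (Get vIN (Plus (Get vROW (Plus (var vN) (Cst 1))) (var vV))) Skip
       (asg vOK (Cst 0))).

Definition cand_pre : com := asg vOK (Cst 1) ;; source_test ;; target_test.

Definition compat_com : com :=
  If (Minus (var vN) (Get vY (var vQ)))
    (If (Minus (Get vNXT (var vP)) (var vQ))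
      (If (Minus (Get vNXT (var vQ)) (var vP))
        (If (Plus (Minus (Get vY (var vQ)) (var vV))
                  (Minus (var vV) (Get vY (var vQ))))
          (If (Get vIN (Plus (Get vROW (Get vY (var vQ))) (var vV)))
             (asg vOK (Cst 0)) Skip)
          (asg vOK (Cst 0)))
        Skip) Skip) Skip.

Definition cand_com : com :=
  cand_pre ;; asg vQ (Cst 0) ;; For vK (compat_com ;; incr vQ).

Definition cands_body : com :=
  cand_com ;;
  If (var vOK)
    (If (Plus (Minus (var vCN) (var vG)) (Minus (var vG) (var vCN)))
       Skip (asg vVAL (var vV)) ;; incr vCN) Skip ;;
  incr vV.

Definition cands_com : com :=
  asg vCN (Cst 0) ;; asg vVAL (var vN) ;; asg vV (Cst 0) ;; For vN cands_body.

Definition best_body : com :=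
  If (Minus (var vN) (Get vY (var vP))) Skip
    (cands_com ;;
     If (Minus (var vBC) (var vCN))
       (asg vBEST (var vP) ;; asg vBC (var vCN) ;; asg vBVAL (var vVAL))
       Skip) ;;
  incr vP.

Definition best_com : com :=
  asg vBEST (var vK) ;; asg vBC (Plus (var vN) (Cst 1)) ;;
  asg vBVAL (var vN) ;; asg vP (Cst 0) ;; For vK best_body.

Definition round_com : com :=
  divmod vCNT ;;
  If (var vFAIL) Skip
    (best_com ;;
     If (Minus (var vBC) (var vB)) (asg vTR (Cst 1)) Skip ;;
     If (Minus (var vN) (var vBVAL))
       (Put vY (var vBEST) (var vBVAL)) (asg vFAIL (Cst 1))).

Definition plan_com : com :=
  divmod vCNT ;;
  If (var vFAIL) Skip
    (If (Minus (var vP) (var vG))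
       (If (Minus (var vK) (Get vNXT (var vG))) (asg vFAIL (Cst 1))
          (Put vNXT (var vG) (var vP)))
       (asg vFAIL (Cst 1))) ;;
  incr vP.

Definition clear_body : com :=
  Put vNXT (var vP) (var vK) ;; Put vY (var vP) (var vN) ;; incr vP.

Definition sim_com : com :=
  asg vU (var vW) ;; asg vFAIL (Cst 0) ;;
  asg vP (Cst 0) ;;
  For vK clear_body ;;
  asg vP (var vKK) ;;
  For vL plan_com ;;
  For vK round_com.

Definition addcnt : com := asg vT (Plus (var vT) (var vCNT)).

Definition power_body : com :=
  asg vT (Cst 0) ;; For vB addcnt ;; asg vCNT (var vT).

Definition reset_com : com :=
  asg vCNT (Cst 1) ;; For vLN power_body ;; asg vTR (Cst 0) ;; asg vW (Cst 0).

Definition setup_com : com := incr vB ;; reset_com.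

Definition scan_body : com :=
  sim_com ;; If (var vFAIL) Skip (asg vRES (Cst 1) ;; asg vDONE (Cst 1)) ;;
  incr vW.

Definition scan_com : com :=
  For vCNT scan_body ;;
  If (var vTR) Skip (asg vDONE (Cst 1)).

Definition unpack_body : com :=
  divmod vT ;; Put vIN (var vI) (var vG) ;; incr vI.

(** The packed bits return to cells 4 to 11, lowest bit first, and cell 3 gets back the diagonal
    entry 0. [vT] keeps the packed value as a bound for the quotients. *)
Definition unpack_com : com :=
  asg vU (Get vIN (Cst 3)) ;; asg vT (var vU) ;; asg vB (Cst 2) ;;
  asg vI (Cst 4) ;; asg vM (Cst 8) ;;
  For vM unpack_body ;;
  Put vIN (Cst 3) (Cst 0).

Definition row_body : com :=
  Put vROW (Plus (var vI) (Cst 1)) (Plus (Get vROW (var vI)) (var vN)) ;;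
  incr vI.

Definition init_com : com :=
  asg vN (Get vIN (Cst 0)) ;; asg vKK (Get vIN (Cst 1)) ;;
  asg vL (Get vIN (Cst 2)) ;; asg vK (Plus (var vKK) (var vL)) ;;
  asg vLN (Plus (var vL) (var vK)) ;;
  asg vM (Plus (var vN) (Cst 1)) ;; Put vROW (Cst 0) (Cst 3) ;;
  asg vI (Cst 0) ;;
  For vM row_body ;;
  asg vB (var vK) ;; asg vDONE (Cst 0) ;; asg vRES (Cst 0).

Definition try_com : com := If (var vDONE) Skip (setup_com ;; scan_com).

(** [vB] starts at [k + l], which is positive, so the [n]-th iteration would use a base larger than
    [n], for which no list can be truncated. *)
Definition main_com : com := unpack_com ;; init_com ;; For vN try_com.

(** * The programs compute the abstract search *)

Lemma cwf_main : cwf main_com 0.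
Proof. by []. Qed.

Lemma den_seq a b s : den (a ;; b) s = den b (den a s).
Proof. by []. Qed.

Lemma den_if e a b s :
  den (If e a b) s = if ev e s != 0 then den a s else den b s.
Proof. by []. Qed.

Lemma den_for x c s : den (For x c) s = iter (s x 0) (den c) s.
Proof. by []. Qed.

Lemma cost_for x c s : cost (For x c) s =
  10 + \sum_(i < s x 0) (cost c (iter i (den c) s) + 4).
Proof. by []. Qed.

Lemma cost_seq a b s : cost (a ;; b) s = cost a s + cost b (den a s).
Proof. by []. Qed.

(** Arrays outside [mods c] are known to keep their initial contents at every step, which spares
    each invariant its frame conditions. *)
Lemma for_inv (I : nat -> store -> Prop) x c s :
  I 0 s ->
  (forall i s', i < s x 0 -> (forall j, j \notin mods c -> s' j = s j) ->
     I i s' -> I i.+1 (den c s')) ->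
  I (s x 0) (den (For x c) s).
Proof.
move=> I0 IS /=.
suff H : forall i, i <= s x 0 -> I i (iter i (den c) s) by apply: H.
elim=> //= i IH Hi; apply: IS => //; last by apply: IH; apply: ltnW.
by move=> j Hj; elim: (i) => //= i' E; rewrite frame.
Qed.

Lemma notin_sub (ys xs : seq nat) j :
  all (fun x => x \in ys) xs -> j \notin ys -> j \notin xs.
Proof. by move=> /allP H; apply: contra => /H. Qed.

Lemma sub_nz a b : (a - b != 0) = (b < a).
Proof. by rewrite -lt0n subn_gt0. Qed.

Lemma dist_nz a b : (a - b + (b - a) != 0) = (a != b).
Proof. by apply/idP/idP => H; lia. Qed.

Lemma divmod_spec x s : x \notin [:: vQ; vU; vG] -> 0 < s vB 0 ->
  s vU 0 <= s x 0 ->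
  den (divmod x) s vU 0 = s vU 0 %/ s vB 0 /\
  den (divmod x) s vG 0 = s vU 0 %% s vB 0.
Proof.
move=> Hx B0 Ux.
rewrite /divmod !den_seq.
pose s1 := den (asg vQ (Cst 0)) s; rewrite -/s1.
have E1 : s1 x = s x.
  rewrite /s1 frame //=; move: Hx; rewrite !inE !negb_or.
  by case/andP.
have := @for_inv (fun i s' => let q := minn i (s vU 0 %/ s vB 0) in
   s' vQ 0 = q /\ s' vU 0 = s vU 0 - q * s vB 0) x divmod_body s1.
rewrite E1; case.
- by rewrite /= min0n mul0n subn0.
- move=> i s' Hi F [EQ EU].
  have EB : s' vB 0 = s vB 0 by rewrite F.
  have D := divn_eq (s vU 0) (s vB 0).
  have M := ltn_pmod (s vU 0) B0.
  rewrite /= sub_nz EB EU.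
  move: EQ EU D M; set a := _ %/ _; set r := _ %% _ => EQ EU D M.
  case: (leqP a i) EQ EU => Ha.
    have -> : minn i.+1 a = a by lia.
    move=> EQ EU; case: ifP => C //.
    by exfalso; nia.
  have -> : minn i.+1 a = i.+1 by lia.
  move=> EQ EU.
  case: ifP => C; last by exfalso; nia.
  by rewrite /= /sset /= EQ; split; lia.
- move: (den (For x divmod_body) s1) => s2 EQ EU; rewrite /= /sset /= EQ EU.
  have H : s vU 0 %/ s vB 0 <= s x 0 by apply: leq_trans (leq_div _ _) Ux.
  rewrite (minn_idPr H); split=> //.
  by rewrite {1}(divn_eq (s vU 0) (s vB 0)) addKn.
Qed.

Section Sim.
Variables (n k K : nat) (S T : nat -> bool) (E : nat -> nat -> bool).

Definition env (s : store) : Prop :=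
  [/\ [/\ s vN 0 = n, s vKK 0 = k & s vK 0 = K],
      forall x v, x < n -> v < n -> (s vIN (s vROW x + v) != 0) = E x v,
      forall v, v < n -> (s vIN (s vROW n + v) != 0) = S v
    & forall v, v < n -> (s vIN (s vROW n.+1 + v) != 0) = T v].

Definition env_vars : seq nat := [:: vIN; vN; vKK; vK; vROW].

Lemma env_eq s s' : (forall j, j \in env_vars -> s' j = s j) ->
  env s -> env s'.
Proof. by move=> F [[H1 H2 H3] H4 H5 H6]; split; rewrite ?F. Qed.

Lemma env_den c s : all (fun j => j \notin mods c) env_vars ->
  env s -> env (den c s).
Proof. by move=> /allP F; apply: env_eq => j Hj; rewrite frame // F. Qed.

Lemma cand_pre_spec s p v : env s -> s vP 0 = p -> s vV 0 = v -> v < n ->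
  den cand_pre s vOK 0 =
    ((p < k) ==> S v) && ((K <= s vNXT p) ==> T v) :> nat.
Proof.
move=> [[H1 H2 H3] _ HS HT] HP HV Hv.
rewrite /cand_pre !den_seq.
set s1 := den source_test _.
have F1 j : j != vOK -> s1 j = s j.
  by move=> Hj; rewrite /s1 !frame //= ?inE.
have -> : den target_test s1 vOK 0 =
   if (K <= s vNXT p) ==> T v then s1 vOK 0 else 0.
  rewrite /= sub_nz (F1 vK) // (F1 vNXT) // (F1 vP) // (F1 vIN) // (F1 vROW) //
    (F1 vN) // (F1 vV) // H1 H3 HP HV addn1 HT // ltnNge.
  by case: (_ <= _) => //=; case: (T v).
have -> : s1 vOK 0 = ((p < k) ==> S v).
  rewrite /s1 /= sub_nz /sset /= H1 H2 HP HV HS //.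
  by case: (p < k) => //=; case: (S v).
by case: (_ ==> S v); case: (_ ==> T v).
Qed.

Lemma compat_spec s p v q : env s -> s vP 0 = p -> s vV 0 = v -> v < n ->
  s vQ 0 = q ->
  den compat_com s vOK 0 = if compat n E (s vNXT) (s vY) p v q then s vOK 0 else 0.
Proof.
move=> [[H1 H2 H3] HE _ _] HP HV Hv HQ.
rewrite /compat /= !sub_nz dist_nz H1 HP HV HQ.
case: (ltnP (s vY q) n) => //= Hy; case: (q < _) => //=; case: (p < _) => //=.
by case: (s vY q != v) => //=; rewrite HE //; case: (E _ _).
Qed.

Lemma cand_spec s p v : env s -> s vP 0 = p -> s vV 0 = v -> v < n ->
  den cand_com s vOK 0 = cand n k K S T E (s vNXT) (s vY) p v.
Proof.
move=> He HP HV Hv; rewrite /cand_com !den_seq.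
set s0 := den cand_pre s.
pose s1 := den (asg vQ (Cst 0)) s0; rewrite -/s1.
have F1 j : j \notin [:: vQ; vOK] -> s1 j = s j.
  by move=> Hj; rewrite /s1 /s0 !frame //; apply: notin_sub Hj.
have HK : s1 vK 0 = K by rewrite F1 //; case: He => [[]].
have := @for_inv (fun i s' => s' vQ 0 = i /\ s' vOK 0 = (s0 vOK 0 != 0) &&
   all (compat n E (s vNXT) (s vY) p v) (iota 0 i) :> nat) vK
   (compat_com ;; incr vQ) s1.
case.
- rewrite /= andbT -[s1 vOK 0]/(s0 vOK 0) /s0 (cand_pre_spec He HP HV Hv).
  by case: (_ && _).
- move=> i s' Hi F [EQ EO].
  have F' j : j \notin [:: vQ; vOK] -> s' j = s j.
    by move=> Hj; rewrite F ?F1 //; apply: notin_sub Hj.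
  have He' : env s'.
    apply: env_eq He => j Hj; apply: F'.
    by move: Hj; rewrite !inE; do ![case/orP] => /eqP ->.
  rewrite den_seq iota_rcons all_rcons.
  have C : den compat_com s' vOK 0 =
      if compat n E (s vNXT) (s vY) p v i then s' vOK 0 else 0.
    by rewrite (@compat_spec s' p v i) ?(F' vNXT) ?(F' vY) ?(F' vP) ?(F' vV).
  have Fq : den compat_com s' vQ = s' vQ by rewrite frame.
  move: C Fq; move: (den compat_com s') => s2 C Fq.
  rewrite /= /sset /= Fq EQ C EO addn1; split=> //.
  rewrite andbCA.
  by case: (compat _ _ _ _ _ _ _) => //=; rewrite ?andbF ?andbT.
rewrite HK => _ ->; congr nat_of_bool.
by rewrite /s0 (cand_pre_spec He HP HV Hv) /cand andbA eqb0 negbK.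
Qed.

End Sim.

Section Sim.
Variables (n k K : nat) (S T : nat -> bool) (E : nat -> nat -> bool).
Local Notation env := (env n k K S T E).
Local Notation cand := (cand n k K S T E).
Local Notation cands := (cands n k K S T E).
Local Notation best := (best n k K S T E).

Lemma cands_spec s p : env s -> s vP 0 = p ->
  den cands_com s vCN 0 = size (cands (s vNXT) (s vY) p) /\
  den cands_com s vVAL 0 = nth n (cands (s vNXT) (s vY) p) (s vG 0).
Proof.
move=> He HP; rewrite /cands_com !den_seq.
set s1 := den (asg vV (Cst 0)) _.
have F1 j : j \notin [:: vCN; vVAL; vV] -> s1 j = s j.
  by move=> Hj; rewrite /s1 !frame //; apply: notin_sub Hj.
have HN : s vN 0 = n by case: He => [[]].
have HN1 : s1 vN 0 = n by rewrite F1.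
pose l i := filter (cand (s vNXT) (s vY) p) (iota 0 i).
have := @for_inv (fun i s' => [/\ s' vV 0 = i, s' vCN 0 = size (l i)
   & s' vVAL 0 = nth n (l i) (s vG 0)]) vN cands_body s1.
rewrite HN1; case=> [|i s' Hi F [EV EC EL]|_ -> ->] //.
  by rewrite /l /= /sset /= nth_nil; split.
have F' j : j \notin [:: vCN; vVAL; vV; vOK; vQ] -> s' j = s j.
  move=> Hj; rewrite F ?F1 //; last by apply: notin_sub Hj.
  by apply: contra Hj; rewrite !inE => /or3P [] /eqP ->.
have He' : env s'.
  apply: env_eq He => j Hj; apply: F'.
  by move: Hj; rewrite !inE; do ![case/orP] => /eqP ->.
rewrite /cands_body den_seq.
have C : den cand_com s' vOK 0 = cand (s vNXT) (s vY) p i.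
  by rewrite (cand_spec He' (erefl _) (erefl _)) ?EV // !F' ?HP.
have FC j : j \notin [:: vOK; vQ] -> den cand_com s' j = s' j.
  by move=> Hj; rewrite frame //; apply: notin_sub Hj.
have := FC vCN isT; have := FC vVAL isT; have := FC vV isT; have := FC vG isT.
rewrite F' //; move: C; move: (den cand_com s') => s2 C HG HV HL HC.
rewrite /l iota_rcons filter_rcons -/(l i).
rewrite den_seq.
set s3 := den (If (var vOK) _ _) s2.
have [V3 C3 L3] : [/\ s3 vV 0 = i,
    s3 vCN 0 = if cand (s vNXT) (s vY) p i then (size (l i)).+1 else size (l i)
  & s3 vVAL 0 = if cand (s vNXT) (s vY) p i && (s vG 0 == size (l i)) then i
      else nth n (l i) (s vG 0)].
  rewrite /s3 /= C; case: (cand _ _ _ _) => /=.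
    rewrite dist_nz HC HG EC eq_sym.
    by case: (s vG 0 == size (l i)); rewrite /= /sset /= ?HV ?HC ?EC ?HL ?addn1.
  by rewrite HV HC HL.
rewrite /= /sset /= V3 C3 L3 addn1.
case: (cand _ _ _ _) => //=; rewrite size_rcons nth_rcons; split=> //.
case: ltngtP => // H; by rewrite nth_default // ltnW.
Qed.

Lemma best_spec s : env s ->
  (den best_com s vBEST 0, den best_com s vBC 0, den best_com s vBVAL 0) =
  best (s vNXT) (s vY) (s vG 0) K.
Proof.
move=> He; rewrite /best_com !den_seq.
set s1 := den (asg vP (Cst 0)) _.
have F1 j : j \notin [:: vBEST; vBC; vBVAL; vP] -> s1 j = s j.
  by move=> Hj; rewrite /s1 !frame //; apply: notin_sub Hj.
have [[HN _ HK] _ _ _] := He.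
have HK1 : s1 vK 0 = K by rewrite F1.
have := @for_inv (fun i s' => s' vP 0 = i /\
   (s' vBEST 0, s' vBC 0, s' vBVAL 0) = best (s vNXT) (s vY) (s vG 0) i)
   vK best_body s1.
rewrite HK1; case=> [|i s' Hi F [EP EB]|_ ->]; last by [].
  by rewrite /s1 /= /sset /= HN HK addn1.
pose ch := [:: vBEST; vBC; vBVAL; vP; vCN; vVAL; vV; vOK; vQ].
have F' j : j \notin ch -> s' j = s j.
  move=> Hj; rewrite F ?F1 //; last by apply: notin_sub Hj.
  by apply: contra Hj; rewrite !inE => /or4P [] /eqP ->.
have He' : env s'.
  apply: env_eq He => j Hj; apply: F'.
  by move: Hj; rewrite !inE; do ![case/orP] => /eqP ->.
have EY : ev (Minus (var vN) (Get vY (var vP))) s' = n - s vY i.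
  by rewrite /= (F' vN) // (F' vY) // HN EP.
rewrite /best_body den_seq den_if EY sub_nz [best _ _ _ _]/= (leqNgt n).
set s3 := den (cands_com ;; _) s'.
case: (ltnP (s vY i) n) => Hy; first by rewrite /= /sset /= EP addn1.
rewrite /s3.
have [C1 C2] := cands_spec He' EP.
rewrite (F' vNXT) // (F' vY) // (F' vG) // in C1 C2.
have FC j : j \notin [:: vCN; vVAL; vV; vOK; vQ] -> den cands_com s' j = s' j.
  by move=> Hj; rewrite frame //; apply: notin_sub Hj.
rewrite den_seq.
move: (FC vBEST isT) (FC vBC isT) (FC vBVAL isT) (FC vP isT) C1 C2.
move: (den cands_com s') => s2 F2 F3 F4 F5 C1 C2.
rewrite -EB [in RHS]/= den_if /= sub_nz F3 C1.
by case: ifP => _; rewrite /= /sset /= ?F2 ?F3 ?F4 ?F5 ?C1 ?C2 ?EP addn1 -?EB.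
Qed.

End Sim.

Section Sim.
Variables (n k K : nat) (S T : nat -> bool) (E : nat -> nat -> bool).
Local Notation env := (env n k K S T E).
Local Notation best := (best n k K S T E).
Local Notation round := (round n k K S T E).
Local Notation plan_step := (plan_step K).
Local Notation sim := (sim n k K S T E).

Lemma env_vals s : env s -> [/\ s vN 0 = n, s vKK 0 = k & s vK 0 = K].
Proof. by case. Qed.

(** [vTR] is shared by all branches of a base: [t0] is the contribution of earlier branches, [tr]
    that of the current one. *)
Lemma round_spec s y (fail tr t0 : bool) :
  env s -> 0 < s vB 0 -> s vU 0 <= s vCNT 0 ->
  s vY = y -> s vFAIL 0 = fail -> s vTR 0 = t0 || tr ->
  let st := round (s vB 0) (s vNXT) (y, fail, tr) (s vU 0 %% s vB 0) in
  [/\ den round_com s vU 0 = s vU 0 %/ s vB 0, den round_com s vY = st.1.1,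
      den round_com s vFAIL 0 = st.1.2 & den round_com s vTR 0 = t0 || st.2].
Proof.
move=> He HB HU HY HF HT st.
rewrite /round_com den_seq.
have [U1 G1] := @divmod_spec vCNT s isT HB HU.
have F1 j : j \notin [:: vQ; vU; vG] -> den (divmod vCNT) s j = s j.
  by move=> Hj; apply: frame; apply: notin_sub Hj.
have He1 : env (den (divmod vCNT) s) by apply: env_den.
move: (F1 vY isT) (F1 vFAIL isT) (F1 vTR isT) (F1 vB isT) (F1 vNXT isT) He1 U1 G1.
move: (den (divmod vCNT) s) => s1 FY FF FT FB FN He1 U1 G1.
rewrite den_if den_seq.
have -> : (ev (var vFAIL) s1 != 0) = fail by rewrite /= FF HF; case: (fail).
rewrite /st /round.
case: (fail) HF => HF; first by rewrite /= FY FF FT.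
have := best_spec He1; rewrite G1 FN FY HY => BB.
pose ch := [:: vBEST; vBC; vBVAL; vP; vCN; vVAL; vV; vOK; vQ].
have F2 j : j \notin ch -> den best_com s1 j = s1 j.
  by move=> Hj; apply: frame; apply: notin_sub Hj.
have [HN1 _ _] := env_vals He1.
move: (F2 vY isT) (F2 vFAIL isT) (F2 vTR isT) (F2 vB isT) (F2 vU isT) (F2 vN isT) BB.
move: (den best_com s1) => s2 F2Y F2F F2T F2B F2U F2N.
case: (best _ _ _ _) => [[b c] v] [B1 B2 B3].
rewrite den_seq; set s3 := den (If (Minus (var vBC) (var vB)) _ _) s2.
have F3 j : j != vTR -> s3 j = s2 j.
  by move=> Hj; apply: frame; rewrite /= inE.
have T3 : s3 vTR 0 = t0 || (tr || (s vB 0 < c)).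
  rewrite /s3 /= sub_nz F2B FB B2.
  by case: ifP => H; rewrite ?orbT ?orbF // F2T FT.
rewrite den_if.
have -> : (ev (Minus (var vN) (var vBVAL)) s3 != 0) = (v < n).
  by rewrite /= sub_nz (F3 vN) // (F3 vBVAL) // B3 F2N HN1.
case: ltnP => Hv.
  split; rewrite /= /sset /= ?T3 //.
  - by rewrite (F3 vU) // F2U.
  - by rewrite (F3 vY) // F2Y FY HY (F3 vBEST) // B1 (F3 vBVAL) // B3.
  - by rewrite (F3 vFAIL) // F2F FF.
split; rewrite /= /sset /= ?T3 //.
- by rewrite (F3 vU) // F2U.
- by rewrite -[RHS]HY -FY -F2Y -(F3 vY).
Qed.

Lemma plan_spec s p nxt (fail : bool) :
  s vK 0 = K -> 0 < s vB 0 -> s vU 0 <= s vCNT 0 ->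
  s vP 0 = p -> s vNXT = nxt -> s vFAIL 0 = fail ->
  let st := plan_step (p, nxt, fail) (s vU 0 %% s vB 0) in
  [/\ den plan_com s vU 0 = s vU 0 %/ s vB 0, den plan_com s vP 0 = st.1.1,
      den plan_com s vNXT = st.1.2 & den plan_com s vFAIL 0 = st.2].
Proof.
move=> HK HB HU HP HN HF st.
rewrite /plan_com den_seq.
have [U1 G1] := @divmod_spec vCNT s isT HB HU.
have F1 j : j \notin [:: vQ; vU; vG] -> den (divmod vCNT) s j = s j.
  by move=> Hj; apply: frame; apply: notin_sub Hj.
move: (F1 vP isT) (F1 vFAIL isT) (F1 vK isT) (F1 vNXT isT) U1 G1.
move: (den (divmod vCNT) s) => s1 FP FF FK FN U1 G1.
rewrite den_seq den_if.
have -> : (ev (var vFAIL) s1 != 0) = fail by rewrite /= FF HF; case: (fail).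
rewrite /st /plan_step.
case: (fail) HF => HF; first by rewrite /= /sset /= FP FN FF HN HF U1 HP addn1.
rewrite den_if.
have -> : (ev (Minus (var vP) (var vG)) s1 != 0) = (s vU 0 %% s vB 0 < p).
  by rewrite /= sub_nz FP HP G1.
rewrite den_if.
have -> : (ev (Minus (var vK) (Get vNXT (var vG))) s1 != 0) =
    ~~ (K <= nxt (s vU 0 %% s vB 0)).
  by rewrite /= sub_nz -ltnNge FK HK FN HN G1.
case: ltnP => Hg /=; last by rewrite /sset /= FP FN HN U1 HP addn1.
case: (_ <= _) => /=; last by rewrite /sset /= FP FN HN U1 HP addn1.
by rewrite /sset /= FP FN FF HN HF U1 G1 HP addn1.
Qed.

Lemma clear_spec s : env s ->
  let s' := den (For vK clear_body) (den (asg vP (Cst 0)) s) in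
  s' vNXT = (fun p => if p < K then K else s vNXT p) /\
  s' vY = (fun p => if p < K then n else s vY p).
Proof.
move=> He s'; rewrite {}/s'; set s1 := den (asg vP (Cst 0)) s.
have [HN _ HK] := env_vals He.
have := @for_inv (fun i s' => [/\ s' vP 0 = i,
   s' vNXT = (fun p => if p < i then K else s vNXT p)
   & s' vY = (fun p => if p < i then n else s vY p)]) vK clear_body s1.
have -> : s1 vK 0 = K by [].
case=> [|i s' Hi F [EP EN EY]|_ -> -> //] //.
have FK : s' vK 0 = K by rewrite F.
have FN : s' vN 0 = n by rewrite F.
rewrite /= /sset /= EP EN EY FK FN addn1; split=> //;
  apply: functional_extensionality => p;
  have -> : (p < i.+1) = (p == i) || (p < i) by rewrite ltnS leq_eqVlt.
- by case: eqP.
- by case: eqP.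
Qed.

Lemma sim_spec s l (t0 : bool) (B := s vB 0) (W := s vW 0)
  (ds1 := digits B 0 l W) (ds2 := digits B l K W)
  (nxt0 := fun p => if p < K then K else s vNXT p)
  (y0 := fun p => if p < K then n else s vY p)
  (st := sim B nxt0 y0 ds1 ds2) :
  env s -> s vL 0 = l -> 0 < B -> W <= s vCNT 0 -> s vTR 0 = t0 ->
  [/\ den sim_com s vFAIL 0 = st.1.2, den sim_com s vTR 0 = t0 || st.2,
      den sim_com s vNXT = (plan k K nxt0 ds1).1.2
    & den sim_com s vY = st.1.1].
Proof.
move=> He HL HB HW HT.
rewrite /sim_com !den_seq.
set s1 := den (asg vFAIL (Cst 0)) _.
have He1 : env s1 by apply: env_den.
have [N2 Y2] := clear_spec He1.
set s2 := den (For vK clear_body) _ in N2 Y2 *.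
have F2 j : j \notin [:: vNXT; vY; vP] -> s2 j = s1 j.
  by move=> Hj; rewrite /s2 !frame //; apply: notin_sub Hj.
have He2 : env s2 by apply: env_den => //; apply: env_den.
have [HN HK1 HK] := env_vals He2.
set s3 := den (asg vP (var vKK)) s2.
have F3 j : j != vP -> s3 j = s2 j by move=> Hj; apply: frame; rewrite /= inE.
have He3 : env s3 by apply: env_den.
have L3 : s3 vL 0 = l by rewrite F3 // F2.
have U3 : s3 vU 0 = W by rewrite F3 // F2.
have B3 : s3 vB 0 = B by rewrite F3 // F2.
have C3 : s3 vCNT 0 = s vCNT 0 by rewrite F3 // F2.
have Fl3 : s3 vFAIL 0 = 0 by rewrite F3 // F2.
have P3 : s3 vP 0 = k by rewrite /s3 /= /sset /=.
have HWi i : W %/ B ^ i <= s vCNT 0 by apply: leq_trans (leq_div _ _) HW.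
have := @for_inv (fun i s' => let st1 := plan k K nxt0 (digits B 0 i W) in
   [/\ s' vU 0 = W %/ B ^ i, s' vP 0 = st1.1.1, s' vNXT = st1.1.2
   & s' vFAIL 0 = st1.2]) vL plan_com s3.
rewrite L3; case.
- by rewrite /= U3 P3 F3 // N2 Fl3 expn0 divn1.
- move=> i s' Hi F [EU EP EN EF].
  have FB : s' vB 0 = B by rewrite F.
  have FC : s' vCNT 0 = s vCNT 0 by rewrite F.
  have FK : s' vK 0 = K by rewrite F // F3.
  move=> st1.
  have E1 : st1 = plan_step (plan k K nxt0 (digits B 0 i W)) (W %/ B ^ i %% B).
    by rewrite /st1 /digits iota_rcons map_rcons /plan -cats1 foldl_cat.
  move: EP EN EF; rewrite E1; case: (plan _ _ _ _) => [[p nxt] fail] EP EN EF.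
  have [||] := @plan_spec s' p nxt fail FK _ _ EP EN EF; rewrite ?FB ?FC ?EU //.
  by move=> -> -> -> ->; rewrite -divnMA expnSr.
set s4 := den (For vL plan_com) s3.
move=> U4 P4 N4 Fl4.
have F4 j : j \notin [:: vQ; vU; vG; vFAIL; vNXT; vP] -> s4 j = s3 j.
  by move=> Hj; apply: frame; apply: notin_sub Hj.
have He4 : env s4 by apply: env_den.
have B4 : s4 vB 0 = B by rewrite F4.
have C4 : s4 vCNT 0 = s vCNT 0 by rewrite F4.
have [_ _ HK4] := env_vals He4.
have Y4 : s4 vY = y0 by rewrite F4 // F3.
have T4 : s4 vTR 0 = t0 by rewrite F4 // F3 // F2.
pose nxt := (plan k K nxt0 ds1).1.2.
have := @for_inv (fun i s' => let st2 := foldl (round B nxt)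
      (y0, (plan k K nxt0 ds1).2, false) (digits B l i W) in
   [/\ s' vU 0 = W %/ B ^ (l + i), s' vY = st2.1.1, s' vFAIL 0 = st2.1.2
   & s' vTR 0 = t0 || st2.2]) vK round_com s4.
rewrite HK4; case.
- by rewrite /= U4 Y4 Fl4 T4 orbF addn0.
- move=> i s' Hi F [EU EY EF ET].
  have FB : s' vB 0 = B by rewrite F.
  have FC : s' vCNT 0 = s vCNT 0 by rewrite F.
  have FN : s' vNXT = nxt by rewrite F.
  have He' : env s'.
    apply: env_eq He4 => j Hj; apply: F.
    by move: Hj; rewrite !inE; do ![case/orP] => /eqP ->.
  move=> st2.
  have E2 : st2 = round B nxt (foldl (round B nxt)
      (y0, (plan k K nxt0 ds1).2, false) (digits B l i W)) (W %/ B ^ (l + i) %% B).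
    by rewrite /st2 /digits iota_rcons map_rcons -cats1 foldl_cat.
  move: EY EF ET; rewrite E2.
  case: (foldl _ _ _) => [[y fail] tr] EY EF ET.
  have [||] := @round_spec s' y fail tr t0 He' _ _ EY EF ET; rewrite ?FB ?FC ?EU ?FN //.
  by move=> -> -> -> ->; rewrite -divnMA -expnSr addnS.
move=> _ Y5 Fl5 T5; split; rewrite ?Y5 ?Fl5 ?T5 //.
by rewrite frame // N4.
Qed.

End Sim.

(** * Reconfiguration sequences with idle moves *)

(** The condition [v \notin I :\ u] admits [v = u], an idle move. This turns at most [l] jumps into
    exactly [l] slides, one for each target variable. *)
Definition slide (n : nat) (I J : {set 'I_n}) : Prop :=
  exists u v, [/\ u \in I, v \notin I :\ u & J = v |: (I :\ u)].

Lemma compress_slides n (e : rel 'I_n) k l (I : nat -> {set 'I_n}) :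
  (forall j, j < l -> slide (I j) (I j.+1)) ->
  (forall j, j <= l -> indep e (I j) && (#|I j| == k)) ->
  exists p, [/\ size p <= l, path (@tjump n) (I 0) p, last (I 0) p = I l
     & all (fun J => indep e J && (#|J| == k)) (I 0 :: p)].
Proof.
elim: l => [|l IH] Hs Hg; first by exists [::]; split=> //=; rewrite Hg.
have [||p [Hp Pp Lp Ap]] := IH.
- by move=> j Hj; apply: Hs; lia.
- by move=> j Hj; apply: Hg; lia.
have [u [v [Hu Hv E]]] := Hs l (ltnSn l).
case: (u =P v) => [uv|/eqP uv].
  exists p; split=> //; first by lia.
  by rewrite Lp E -uv setD1K.
exists (rcons p (I l.+1)); split.
- by rewrite size_rcons.
- rewrite rcons_path Pp Lp /=; apply/existsP; exists u; rewrite Hu /=.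
  apply/existsP; exists v; rewrite E eqxx andbT inE.
  by move: Hv; rewrite !inE eq_sym uv.
- by rewrite last_rcons.
- by rewrite -rcons_cons all_rcons Ap Hg.
Qed.

Lemma slides_of_yes n (e : rel 'I_n) (S T : {set 'I_n}) k l :
  0 < k -> tjo_yes e S T k l ->
  exists I : nat -> {set 'I_n}, [/\ I 0 = S, I l = T,
    forall j, j < l -> slide (I j) (I j.+1)
    & forall j, j <= l -> indep e (I j) && (#|I j| == k)].
Proof.
move=> k0 [p [Hp Pp Lp Ap]].
pose I j := nth T (S :: p) j.
have It j : size p <= j -> I j = T.
  rewrite leq_eqVlt => /orP [/eqP <-|Hj]; first by rewrite /I nth_last /= Lp.
  by rewrite /I nth_default.
have Ig j : indep e (I j) && (#|I j| == k).
  case: (leqP j (size p)) => Hj.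
    by move/(all_nthP T): Ap => /(_ j); apply; rewrite /= ltnS.
  rewrite (It j (ltnW Hj)) -(It _ (leqnn _)).
  by move/(all_nthP T): Ap => /(_ (size p)); apply.
exists I; split=> //; first exact: It.
move=> j _; case: (ltnP j (size p)) => Hj.
  move/(pathP T): Pp => /(_ j Hj) /existsP [u /andP [Hu /existsP [v /andP [Hv /eqP E]]]].
  exists u, v; split=> //; move: Hv; rewrite !inE.
  by apply: contra => /andP [].
rewrite (It _ Hj) (It j.+1); last by lia.
(* Padding with idle moves at [T] needs a token to stay in place, which is where [0 < k] enters. *)
have /card_gt0P [u Hu] : 0 < #|T|.
  by have := Ig (size p); rewrite It // => /andP [_ /eqP ->].
by exists u, u; split=> //; rewrite ?setD1K // !inE eqxx.
Qed.

(** * Independent transversals in degenerate graphs *)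

(* Assign a vertex of degree at most [d] in the union of the lists to one of
   the lists containing it: every other list loses at most [d + 1] vertices. *)
Lemma degenerate_transversal n (e : rel 'I_n) d (x0 : 'I_n) (U : seq nat)
    (L : nat -> {set 'I_n}) :
  symmetric e -> degenerate e d -> uniq U ->
  (forall p, p \in U -> d.+1 * size U <= #|L p|) ->
  exists y : nat -> 'I_n, (forall p, p \in U -> y p \in L p) /\
    (forall p q, p \in U -> q \in U -> p != q ->
       y p != y q /\ ~~ e (y p) (y q)).
Proof.
move=> se De; move Em : (size U) => m.
elim: m U Em L => [|m IH] U Em L Uu HL.
  by move/size0nil: Em => ->; exists (fun=> x0); split.
pose A := [set x | has (fun p => x \in L p) U].
have LA p : p \in U -> L p \subset A.
  by move=> Hp; apply/subsetP => x Hx; rewrite inE; apply/hasP; exists p.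
have A0 : A != set0.
  have [p pU] : exists p, p \in U.
    by exists (head 0 U); case: (U) Em => //= a r _; rewrite mem_head.
  have : 0 < #|L p| by apply: leq_trans (HL p pU); rewrite muln_gt0.
  case/card_gt0P => x Hx; apply/set0Pn; exists x.
  exact: (subsetP (LA p pU)).
have [x xA xd] := De A A0.
have [p pU xp] : exists2 p, p \in U & x \in L p.
  by move: xA; rewrite inE => /hasP.
pose D := x |: [set z in A | e x z].
have cD : #|D| <= d.+1 by rewrite /D cardsU1; case: (_ \notin _); lia.
have Us : size (rem p U) = m by rewrite size_rem // Em.
have remU q : q \in rem p U = (q != p) && (q \in U) by rewrite mem_rem_uniq // inE.
have [||y [yL yI]] := IH _ Us (fun q => L q :\: D).
- exact: rem_uniq.
- move=> q; rewrite remU => /andP [_ qU]; have := HL q qU.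
  by rewrite -(cardsID D (L q)) => H; have := subset_leq_card (subsetIr (L q) D); lia.
exists (fun q => if q == p then x else y q).
have yD q : q \in U -> q != p -> x != y q /\ ~~ e x (y q).
  move=> qU qp; have := yL q; rewrite remU qU qp => /(_ isT).
  rewrite in_setD /D in_setU1 negb_or in_set => /andP [/andP [H1 H2] H3].
  split; first by rewrite eq_sym.
  by move: H2; rewrite (subsetP (LA q qU)).
split=> [q qU|q r qU rU qr].
  case: eqP => [->//|/eqP qp]; have := yL q; rewrite remU qU qp => /(_ isT).
  by rewrite inE => /andP [].
case: (q =P p) => [Eq|/eqP Hq]; case: (r =P p) => [Er|/eqP Hr].
- by move: qr; rewrite Eq Er eqxx.
- exact: yD.
- by have [] := yD q qU Hq; rewrite eq_sym se.
- by apply: yI => //; rewrite remU ?Hq ?Hr.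
Qed.

(** If [A] lies inside [N], no degree in [A] exceeds [#|N|]; otherwise a vertex of degree at most
    [d] in [A :\: N] gains at most [#|N|] neighbours in [A]. *)
Lemma degenerate_of_minus n (e : rel 'I_n) (N : {set 'I_n}) d :
  degenerate_minus e N d -> degenerate e (#|N| + d).
Proof.
move=> H A A0; case: (boolP (A \subset N)) => AN.
  have /set0Pn [x xA] := A0; exists x => //.
  apply: leq_trans (leq_addr _ _); apply: subset_leq_card.
  by apply: subset_trans AN; apply/subsetP => y; rewrite inE => /andP [].
have B0 : A :\: N != set0 by rewrite setD_eq0.
have BN : A :\: N \subset ~: N by rewrite setDE subsetIr.
have [x] := H _ B0 BN; rewrite inE => /andP [_ xA] Hx; exists x => //.
apply: leq_trans (_ : #|N :|: [set y in A :\: N | e x y]| <= _).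
  apply: subset_leq_card; apply/subsetP => y; rewrite !inE.
  by case: (y \in N) => //=.
by apply: leq_trans (leq_card_setU _ _) _; rewrite leq_add2l.
Qed.

(** * Correctness of the search *)

(** A stronger filter can only remove entries in front of [x]. Applied to candidate lists, it keeps
    the digit that points to a fixed value from growing while other variables are assigned. *)
Lemma index_filter_sub (a1 a2 : pred nat) x s :
  subpred a2 a1 -> a2 x -> index x (filter a2 s) <= index x (filter a1 s).
Proof.
move=> H Hx; elim: s => //= z s IH; case: ifP => Hz.
  by rewrite (H _ Hz) /=; case: eqP.
case: ifP => _ //=; case: eqP => [E|_]; last exact: leqW.
by rewrite E Hx in Hz.
Qed.

Lemma foldl_cons (X : Type) (f : X -> nat -> X) st g ds :
  foldl f st (g :: ds) = foldl f (f st g) ds.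
Proof. by []. Qed.

Section Search.
Variables (n k K : nat) (S T : nat -> bool) (E : nat -> nat -> bool).
Hypothesis E_sym : forall x y, x < n -> y < n -> E x y = E y x.
Local Notation cand := (cand n k K S T E).
Local Notation cands := (cands n k K S T E).
Local Notation best := (best n k K S T E).
Local Notation round := (round n k K S T E).

(** Variable [p] is occupied during the interval from [p] to [nxt p], right end excluded; conflict
    means that two such intervals meet. Initial tokens conflict pairwise because replacements only
    start at [k]. *)
Definition conflict (nxt : nat -> nat) (p q : nat) : bool :=
  (q < nxt p) && (p < nxt q).

Definition consistent (nxt y : nat -> nat) : Prop :=
  forall p, p < K -> y p < n ->
    [/\ p < k -> S (y p), K <= nxt p -> T (y p)
      & forall q, q < K -> q != p -> y q < n -> conflict nxt p q ->
          y q != y p /\ ~~ E (y q) (y p)].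

Definition extends (y ys : nat -> nat) : Prop :=
  forall q, q < K -> y q < n -> y q = ys q.

Definition unassigned (y : nat -> nat) : seq nat :=
  filter (fun p => n <= y p) (iota 0 K).

Lemma candP nxt y p v : reflect
  [/\ p < k -> S v, K <= nxt p -> T v
    & forall q, q < K -> y q < n -> conflict nxt p q ->
        y q != v /\ ~~ E (y q) v]
  (cand nxt y p v).
Proof.
apply: (iffP and3P) => [[/implyP H1 /implyP H2 /allP H3]|[H1 H2 H3]].
  split=> // q qK yq /andP [c1 c2].
  have := H3 q; rewrite mem_iota add0n qK => /(_ isT).
  by rewrite /compat yq c1 c2 /= => /andP.
split; [exact/implyP|exact/implyP|].
apply/allP => q; rewrite mem_iota add0n /= => qK.
apply/implyP => /and3P [yq c1 c2].
by apply/andP; apply: H3 => //; rewrite /conflict c1.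
Qed.

Lemma mem_cands nxt y p v : (v \in cands nxt y p) = (v < n) && cand nxt y p v.
Proof. by rewrite mem_filter mem_iota add0n andbC. Qed.

Lemma size_cands nxt y p : size (cands nxt y p) <= n.
Proof. by rewrite size_filter -[X in _ <= X](size_iota 0); apply: count_size. Qed.

Lemma conflictC nxt p q : conflict nxt p q = conflict nxt q p.
Proof. by rewrite /conflict andbC. Qed.

Lemma updE (y : nat -> nat) p v q : upd y p v q = if q == p then v else y q.
Proof. by []. Qed.

Lemma consistent_upd nxt y p v : consistent nxt y -> p < K -> n <= y p ->
  v < n -> cand nxt y p v -> consistent nxt (upd y p v).
Proof.
move=> Hc pK yp vn /candP [c1 c2 c3] q qK; rewrite updE.
case: eqP => [->|/eqP qp] yq.
  split=> // r rK rp; rewrite updE (negbTE rp) => yr cf.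
  exact: c3.
have [d1 d2 d3] := Hc q qK yq; split=> // r rK rq; rewrite updE.
case: eqP => [->|_]; last exact: d3.
move=> _ cf; rewrite conflictC in cf; have [H1 H2] := c3 q qK yq cf.
by rewrite eq_sym E_sym.
Qed.

Lemma cand_of_solution nxt y ys p : consistent nxt ys -> extends y ys ->
  p < K -> n <= y p -> ys p < n -> cand nxt y p (ys p).
Proof.
move=> Hc Hx pK yp ysp; have [c1 c2 c3] := Hc p pK ysp.
apply/candP; split=> // q qK yq cf.
rewrite Hx //; apply: c3 => //; last by rewrite -Hx.
by apply: contraTneq yq => ->; rewrite -leqNgt.
Qed.

Lemma cand_upd nxt y b v p w : n <= y b -> cand nxt (upd y b v) p w ->
  cand nxt y p w.
Proof.
move=> yb /candP [c1 c2 c3]; apply/candP; split=> // q qK yq cf.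
have qb : q == b = false.
  by apply/negbTE; apply: contraTneq yq => ->; rewrite -leqNgt.
by have := c3 q qK; rewrite updE qb; apply.
Qed.

Lemma size_unassigned_upd y p v : p < K -> n <= y p -> v < n ->
  size (unassigned y) = (size (unassigned (upd y p v))).+1.
Proof.
move=> pK yp vn.
have -> : unassigned (upd y p v) = rem p (unassigned y).
  rewrite rem_filter ?filter_uniq ?iota_uniq // -filter_predI.
  apply: eq_filter => q /=; rewrite updE.
  by case: eqP => //= _; rewrite leqNgt vn.
have pU : p \in unassigned y by rewrite mem_filter yp mem_iota.
by rewrite size_rem // prednK //; case: (unassigned y) pU.
Qed.

(** The digit affects only the value, so the variable to branch on is determined before the digit is
    chosen. *)
Lemma best_fst nxt y g g' i : (best nxt y g i).1 = (best nxt y g' i).1.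
Proof. by elim: i => //= i IH; rewrite IH; case: ifP. Qed.

Lemma bestP nxt y g i : i <= K ->
  let: (b, c, v) := best nxt y g i in
  (forall p, p < i -> y p < n) /\ (b, c, v) = (K, n.+1, n) \/
  [/\ b < i, n <= y b, c = size (cands nxt y b), v = nth n (cands nxt y b) g
    & forall p, p < i -> n <= y p -> c <= size (cands nxt y p)].
Proof.
elim: i => [|i IH] Hi /=; first by left.
have := IH (ltnW Hi); case: (best _ _ _ _) => [[b c] v] /= {}IH.
case: ifP => [/andP [yi ci]|H].
  right; split=> // p; rewrite ltnS leq_eqVlt => /orP [/eqP ->//|pi] yp.
  case: IH => [[A _]|[_ _ _ _ A]]; last by apply: leq_trans (ltnW ci) (A _ pi yp).
  by have := A p pi; rewrite ltnNge yp.
case: IH => [[A E0]|[A1 A2 A3 A4 A5]].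
  left; split=> // p; rewrite ltnS leq_eqVlt => /orP [/eqP ->|]; last exact: A.
  have cE : c = n.+1 by case: E0.
  by move: H; rewrite cE ltnS size_cands andbT => /negbT; rewrite -ltnNge.
right; split=> //; first exact: ltnW.
move=> p; rewrite ltnS leq_eqVlt => /orP [/eqP -> yi|]; last exact: A5.
by move: H; rewrite yi /= => /negbT; rewrite -leqNgt.
Qed.

Lemma roundP nxt y : unassigned y != [::] ->
  exists b, [/\ b < K, n <= y b,
    forall p, p < K -> n <= y p ->
      size (cands nxt y b) <= size (cands nxt y p)
  & forall B tr g, round B nxt (y, false, tr) g =
      if g < size (cands nxt y b)
      then (upd y b (nth n (cands nxt y b) g), false,
            tr || (B < size (cands nxt y b)))
      else (y, true, tr || (B < size (cands nxt y b)))].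
Proof.
move=> Hu; pose r := best nxt y 0 K; exists r.1.1.
have Hb g : [/\ r.1.1 < K, n <= y r.1.1, r.1.2 = size (cands nxt y r.1.1),
   (best nxt y g K).2 = nth n (cands nxt y r.1.1) g
   & forall p, p < K -> n <= y p -> r.1.2 <= size (cands nxt y p)].
  have := bestP nxt y g (leqnn K); rewrite /r (best_fst _ _ 0 g).
  case: (best _ _ _ _) => [[b c] v] /= [[A _]|[? ? ? ? ?]] //.
  case/negP: Hu; apply/eqP; apply/eqP; rewrite -size_eq0 -leqn0 leqNgt -has_predT.
  apply/hasP => [[p]]; rewrite mem_filter mem_iota => /andP [yp /andP [_ pK]] _.
  by have := A p pK; rewrite ltnNge yp.
have [B1 B2 B3 _ B5] := Hb 0; split=> //; first by rewrite -B3.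
move=> B tr g; rewrite /round.
have := best_fst nxt y g 0 K; rewrite -/r.
have [_ _ _ B4 _] := Hb g; move: B4.
case: (best nxt y g K) => [[b c] v] /= -> E1.
move: B3; rewrite -E1 /= => ->.
case: (ltnP g (size (cands nxt y b))) => Hg.
  by have := mem_nth n Hg; rewrite mem_cands => /andP [Hn _]; rewrite Hn leqNgt Hn.
by rewrite nth_default // ltnn leqnn.
Qed.

Lemma rounds_fail B nxt y tr ds :
  foldl (round B nxt) (y, true, tr) ds = (y, true, tr).
Proof. by elim: ds. Qed.

Lemma rounds_trunc B nxt y fail ds :
  (foldl (round B nxt) (y, fail, true) ds).2 = true.
Proof.
elim: ds y fail => //= g ds IH y [|]; first by rewrite rounds_fail.
by rewrite /round; case: (best _ _ _ _) => [[b c] v] /=.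
Qed.

Lemma rounds_sound B nxt y tr ds : consistent nxt y ->
  (foldl (round B nxt) (y, false, tr) ds).1.2 = false ->
  size ds = size (unassigned y) ->
  let y' := (foldl (round B nxt) (y, false, tr) ds).1.1 in
  consistent nxt y' /\ forall p, p < K -> y' p < n.
Proof.
elim: ds y tr => [|g ds IH] y tr Hc.
  move=> _ /= /esym /size0nil U0; split=> // p pK; rewrite ltnNge; apply/negP => yp.
  have : p \in unassigned y by rewrite mem_filter yp mem_iota.
  by rewrite U0.
move=> Hf Hs; have U0 : unassigned y != [::] by rewrite -size_eq0 -Hs.
have [b [bK yb _ R]] := roundP nxt U0.
move: Hf; rewrite foldl_cons R; case: ifP => Hg; last by rewrite rounds_fail.
have := mem_nth n Hg; rewrite mem_cands => /andP [vn vc] Hf.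
apply: IH => //; first exact: consistent_upd.
by move: Hs; rewrite (size_unassigned_upd bK yb vn) /= => -[].
Qed.

(* A full solution [ys] extending the current assignment is found by choosing,
   in every round, the digit that points to its value, as long as that digit
   is less than [B]; with [flag] one may stop at a list longer than [B]. *)
Lemma rounds_follow (J : (nat -> nat) -> Prop) (flag : bool) B nxt ys :
  0 < B -> consistent nxt ys -> (forall p, p < K -> ys p < n) ->
  (forall y b, J y -> b < K -> n <= y b ->
     flag && (B < size (cands nxt y b)) \/
     index (ys b) (cands nxt y b) < B /\ J (upd y b (ys b))) ->
  forall y tr, J y -> extends y ys ->
  exists ds, [/\ size ds = size (unassigned y), all (fun g => g < B) ds
    & let st := foldl (round B nxt) (y, false, tr) ds in
      st.1.2 = false \/ flag && st.2].
Proof.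
move=> B0 Hc ysn HJ y tr; move Em : (size (unassigned y)) => m.
elim: m y Em tr => [|m IH] y Em tr Jy Hx; first by exists [::]; split=> //; left.
have U0 : unassigned y != [::] by rewrite -size_eq0 Em.
have [b [bK yb _ R]] := roundP nxt U0.
have [/andP [flagT Bs]|[Hi Jy']] := HJ y b Jy bK yb.
  (* Once truncation is recorded, the remaining digits only have to be in range. *)
  exists (nseq m.+1 0); rewrite size_nseq all_nseq B0 orbT; split=> //.
  right; rewrite flagT foldl_cons R Bs orbT.
  by case: ifP => _; rewrite rounds_trunc.
have ysc : ys b \in cands nxt y b.
  by rewrite mem_cands ysn // cand_of_solution // ysn.
have Hx' : extends (upd y b (ys b)) ys.
  by move=> q qK; rewrite updE; case: eqP => [->|_] //; apply: Hx.
have Em' : size (unassigned (upd y b (ys b))) = m.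
  by apply: succn_inj; rewrite -size_unassigned_upd ?ysn.
have [ds [D1 D2 D3]] := IH _ Em' (tr || (B < size (cands nxt y b))) Jy' Hx'.
exists (index (ys b) (cands nxt y b) :: ds); split.
- by rewrite /= D1.
- by rewrite /= Hi.
by rewrite foldl_cons R index_mem ysc nth_index.
Qed.

(** As long as the lists met have length at most [B], every position in them is a digit and [ys] can
    be followed; otherwise the flag gets set. *)
Lemma rounds_complete B nxt ys y : 0 < B -> consistent nxt ys ->
  (forall p, p < K -> ys p < n) -> extends y ys ->
  exists ds, [/\ size ds = size (unassigned y), all (fun g => g < B) ds
    & let st := foldl (round B nxt) (y, false, false) ds in
      st.1.2 = false \/ st.2].
Proof.
move=> B0 Hc ysn Hx.
apply: (@rounds_follow (fun y => extends y ys) true B nxt ys B0 Hc ysn _ y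
  false Hx Hx) => y' b Hx' bK yb.
case: ltnP => Hs; [by left|right; split].
  apply: leq_trans Hs; rewrite index_mem mem_cands ysn //=.
  by apply: cand_of_solution => //; apply: ysn.
by move=> q qK; rewrite updE; case: eqP => [->|_] //; apply: Hx'.
Qed.

(** Lists may be longer than [B] here: what matters is that the values of [ys] start among the first
    [B] candidates, and shrinking lists preserve this. *)
Lemma rounds_small_index B nxt ys y : 0 < B -> consistent nxt ys ->
  (forall p, p < K -> ys p < n) -> extends y ys ->
  (forall p, p < K -> n <= y p -> index (ys p) (cands nxt y p) < B) ->
  exists ds, [/\ size ds = size (unassigned y), all (fun g => g < B) ds
    & (foldl (round B nxt) (y, false, false) ds).1.2 = false].
Proof.
move=> B0 Hc ysn Hx Hi.
have [||ds [D1 D2 [D3|//]]] := @rounds_follow (fun y => extends y ys /\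
   (forall p, p < K -> n <= y p -> index (ys p) (cands nxt y p) < B)) false
   B nxt ys B0 Hc ysn _ y false _ Hx; last by exists ds.
- move=> y' b [Hx' Hi'] bK yb; right; split; first exact: Hi'.
  have Hx2 : extends (upd y' b (ys b)) ys.
    by move=> q qK; rewrite updE; case: eqP => [->|_] //; apply: Hx'.
  split=> // p pK yp.
  have yp' : n <= y' p.
    by move: yp; rewrite updE; case: eqP => // _; rewrite leqNgt ysn.
  apply: leq_ltn_trans (Hi' p pK yp').
  apply: index_filter_sub => [v|]; first exact: cand_upd.
  by apply: cand_of_solution => //; apply: ysn.
- by [].
Qed.

(** The interface through which degeneracy enters the search, phrased with lists of numbers to match
    the candidate lists. *)
Definition transversal_bound (M : nat) : Prop :=
  forall L : nat -> seq nat,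
  (forall p, p < K -> uniq (L p)) ->
  (forall p v, p < K -> v \in L p -> v < n) ->
  forall U, uniq U -> (forall p, p \in U -> p < K) ->
  (forall p, p \in U -> M <= size (L p)) ->
  exists ys, (forall p, p \in U -> ys p \in L p) /\
    forall p q, p \in U -> q \in U -> p != q ->
      ys p != ys q /\ ~~ E (ys p) (ys q).

(** The transversal is taken in the lists cut to their first [B] entries. Its values are pairwise
    non-adjacent, and as candidates they are compatible with the assigned variables, so gluing them
    to [y] gives a solution with small positions. *)
Lemma rounds_of_long_lists B nxt y : 0 < B -> transversal_bound B ->
  consistent nxt y ->
  (forall p, p < K -> n <= y p -> B < size (cands nxt y p)) ->
  exists ds, [/\ size ds = size (unassigned y), all (fun g => g < B) ds
    & (foldl (round B nxt) (y, false, false) ds).1.2 = false].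
Proof.
move=> B0 HB Hc HL.
pose L p := take B (cands nxt y p).
have Lc p v : v \in L p -> v \in cands nxt y p by apply: mem_take.
have memU p : p \in unassigned y -> p < K /\ n <= y p.
  by rewrite mem_filter mem_iota => /andP [].
have [|||||z [zL zI]] := HB L _ _ (unassigned y).
- by move=> p _; rewrite take_uniq // filter_uniq // iota_uniq.
- by move=> p v _ /Lc; rewrite mem_cands => /andP [].
- by rewrite filter_uniq // iota_uniq.
- by move=> p /memU [].
- by move=> p /memU [pK yp]; rewrite size_takel // ltnW // HL.
pose ys p := if y p < n then y p else z p.
have zU p : p < K -> (y p < n) = false -> z p \in L p.
  by move=> pK /negbT; rewrite -leqNgt => yp; apply: zL; rewrite mem_filter yp mem_iota.
have inU p : p < K -> (y p < n) = false -> p \in unassigned y.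
  by move=> pK /negbT; rewrite -leqNgt => yp; rewrite mem_filter yp mem_iota.
have zc p : p < K -> (y p < n) = false -> z p < n /\ cand nxt y p (z p).
  by move=> pK yp; have := Lc _ _ (zU p pK yp); rewrite mem_cands => /andP.
have ysn p : p < K -> ys p < n.
  by move=> pK; rewrite /ys; case: ifP => // yp; case: (zc p pK yp).
have Hx : extends y ys by move=> q qK yq; rewrite /ys yq.
apply: (@rounds_small_index B nxt ys) => //.
  move=> p pK ysp; rewrite /ys in ysp *; case: ifP ysp => yp ysp.
    have [c1 c2 c3] := Hc p pK yp; split=> // q qK qp; case: ifP => yq.
      by move=> _; apply: c3.
    have [zn /candP [_ _ /(_ p pK yp)]] := zc q qK yq.
    by rewrite conflictC eq_sym => H _ cf; rewrite E_sym //; apply: H.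
  have [zn /candP [c1 c2 c3]] := zc p pK yp; split=> // q qK qp.
  case: ifP => yq _; first exact: c3.
  by move=> _; apply: zI => //; apply: inU.
move=> p pK yp; have yF : (y p < n) = false by rewrite ltnNge yp.
have zp := zU p pK yF; rewrite /ys yF.
rewrite -[cands nxt y p](cat_take_drop B) index_cat zp.
by rewrite -{2}(size_takel (ltnW (HL p pK yp))) index_mem.
Qed.

(** The digits before the first truncated round are kept. In that round the shortest list exceeds
    [B], hence all lists do, and the remaining digits are replaced by those of a transversal. *)
Lemma rounds_of_trunc B nxt y ds : 0 < B -> transversal_bound B ->
  consistent nxt y -> size ds = size (unassigned y) ->
  all (fun g => g < B) ds ->
  (foldl (round B nxt) (y, false, false) ds).2 ->
  exists ds', [/\ size ds' = size ds, all (fun g => g < B) ds'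
    & (foldl (round B nxt) (y, false, false) ds').1.2 = false].
Proof.
move=> B0 HB; elim: ds y => [|g ds IH] y Hc Hs Ha //.
have U0 : unassigned y != [::] by rewrite -size_eq0 -Hs.
have [b [bK yb bmin R]] := roundP nxt U0.
case: (ltnP B (size (cands nxt y b))) => HBb.
  move=> _; rewrite Hs; apply: rounds_of_long_lists => // p pK yp.
  by apply: leq_trans HBb (bmin p pK yp).
rewrite foldl_cons R (ltnNge B) HBb /=; case: ifP => Hg; last by rewrite rounds_fail.
have := mem_nth n Hg; rewrite mem_cands => /andP [vn vc] Ht.
have [||||ds' [D1 D2 D3]] := IH (upd y b (nth n (cands nxt y b) g)).
- exact: consistent_upd.
- by move: Hs; rewrite (size_unassigned_upd bK yb vn) /= => -[].
- by case/andP: Ha.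
- by [].
exists (g :: ds'); split; first by rewrite /= D1.
  by case/andP: Ha => /= -> _.
by rewrite foldl_cons R (ltnNge B) HBb Hg.
Qed.

Lemma rounds_short B nxt y fail ds : n < B ->
  (foldl (round B nxt) (y, fail, false) ds).2 = false.
Proof.
move=> nB; elim: ds y fail => //= g ds IH y [|]; first by rewrite rounds_fail.
rewrite /round; have := bestP nxt y g (leqnn K).
case: (best _ _ _ _) => [[b c] v] /= H.
have -> : B < c = false; last exact: IH.
apply/negbTE; rewrite -leqNgt.
case: H => [[_ [_ -> _]]|[_ _ -> _ _]] //.
exact: leq_trans (size_cands _ _ _) (ltnW nB).
Qed.

End Search.

(** * Plans and reconfiguration sequences *)

Section Plans.
Variables (k l : nat).
Local Notation K := (k + l).

(* Every variable [k + i] with [i < j] replaces exactly one earlier variable,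
   and [nxt] maps each replaced variable to its successor. *)
Definition plan_ok (j : nat) (nxt : nat -> nat) : Prop :=
  (forall q, q < K -> nxt q = K \/ (k <= nxt q < k + j /\ q < nxt q)) /\
  (forall i, i < j -> exists r, [/\ r < k + i, nxt r = k + i
     & forall q, q < K -> nxt q = k + i -> q = r]).

Lemma plan_ok_upd j nxt r : j < l -> plan_ok j nxt -> r < k + j -> nxt r = K ->
  plan_ok j.+1 (upd nxt r (k + j)).
Proof.
move=> jl [P1 P2] rj rK; split=> [q qK|i].
  rewrite updE; case: eqP => [->|_]; first by right; split; lia.
  by case: (P1 q qK) => [->|[H1 H2]]; [left|right; split=> //; lia].
rewrite ltnS leq_eqVlt => /orP [/eqP ->|ij].
  exists r; split=> //; first by rewrite updE eqxx.
  move=> q qK; rewrite updE; case: eqP => // _ H.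
  by case: (P1 q qK); lia.
have [r' [R1 R2 R3]] := P2 i ij; exists r'; split=> //.
  by rewrite updE; case: eqP => // E; move: R2; rewrite E rK; lia.
move=> q qK; rewrite updE; case: eqP => [_|_]; [lia|exact: R3].
Qed.

Lemma plan_inv nxt0 ds : (forall q, q < K -> nxt0 q = K) -> size ds <= l ->
  let: (p, nxt, fail) := plan k K nxt0 ds in
  p = k + size ds /\ (fail = false -> plan_ok (size ds) nxt).
Proof.
move=> H0; elim/last_ind: ds => [|ds g IH].
  move=> _; rewrite /plan /= addn0; split=> // _; split=> // q qK.
  by left; apply: H0.
rewrite size_rcons => Hs; rewrite /plan -cats1 foldl_cat -/(plan k K nxt0 ds).
have := IH (ltnW Hs); case: (plan _ _ _ _) => [[p nxt] fail] [-> {}IH].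
rewrite /= addnS; case: (fail) IH => IH //.
case: ifP => // /andP [g1 g2]; split=> // _.
have ok := IH erefl; apply: plan_ok_upd => //.
have [P1 _] := ok; case: (P1 g) => [|//|[]]; lia.
Qed.

Lemma plan_high nxt0 ds q : K <= q -> size ds <= l ->
  (plan k K nxt0 ds).1.2 q = nxt0 q.
Proof.
move=> Kq Hs.
suff : (plan k K nxt0 ds).1.1 = k + size ds /\ (plan k K nxt0 ds).1.2 q = nxt0 q.
  by case.
elim/last_ind: ds Hs => [|ds g IH]; first by rewrite /plan /= addn0.
rewrite size_rcons => Hs; rewrite /plan -cats1 foldl_cat -/(plan k K nxt0 ds).
have := IH (ltnW Hs); case: (plan _ _ _ _) => [[p nxt] fail] /= [-> E].
rewrite addnS; case: (fail) => //; case: ifP => //= /andP [g1 _]; split=> //.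
by rewrite updE; case: eqP => // Eq; lia.
Qed.

End Plans.

Lemma size_digits B o L W : size (digits B o L W) = L.
Proof. by rewrite size_map size_iota. Qed.

Lemma digits_lt B o L W : 0 < B -> all (fun g => g < B) (digits B o L W).
Proof. by move=> B0; apply/allP => g /mapP [j _ ->]; rewrite ltn_pmod. Qed.

Lemma digits_cat B a b W : digits B 0 (a + b) W = digits B 0 a W ++ digits B a b W.
Proof.
rewrite /digits iotaD map_cat; congr cat.
by rewrite [0 + a]addnC iotaDl -map_comp.
Qed.

Lemma digits_surj B ds : all (fun g => g < B) ds ->
  exists2 W, W < B ^ size ds & digits B 0 (size ds) W = ds.
Proof.
elim: ds => [|g ds IH] /=; first by exists 0; rewrite ?expn0.
move=> /andP [gB /IH [W HW E]]; have B0 : 0 < B by apply: leq_ltn_trans gB.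
exists (W * B + g); first by rewrite expnS; nia.
rewrite -[in LHS]add1n digits_cat /= /digits /= /digit addn0 expn0 divn1.
rewrite modnMDl modn_small //.
congr cons; rewrite -[RHS]E; apply: eq_map => j.
rewrite /digit add0n expnD expn1 divnMA divnMDl // (divn_small gB).
by rewrite ?addn0 ?add0n.
Qed.

Lemma digits_surj2 B ds1 ds2 : all (fun g => g < B) ds1 ->
  all (fun g => g < B) ds2 ->
  exists2 W, W < B ^ (size ds1 + size ds2) &
    digits B 0 (size ds1) W = ds1 /\ digits B (size ds1) (size ds2) W = ds2.
Proof.
move=> H1 H2; have := @digits_surj B (ds1 ++ ds2).
rewrite all_cat H1 H2 size_cat => /(_ isT) [W HW]; rewrite digits_cat => /eqP.
rewrite eqseq_cat ?size_digits // => /andP [/eqP E1 /eqP E2].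
by exists W.
Qed.

Section Graph.
Variables (n k l : nat) (e : rel 'I_n) (S T : {set 'I_n}).
Variables (Sn Tn : nat -> bool) (En : nat -> nat -> bool).
Hypothesis e_sym : symmetric e.
Hypothesis e_irr : irreflexive e.
Hypothesis inst : tjo_instance e S T k l.
Hypothesis SnE : forall v : 'I_n, Sn v = (v \in S).
Hypothesis TnE : forall v : 'I_n, Tn v = (v \in T).
Hypothesis EnE : forall u v : 'I_n, En u v = e u v.
Local Notation K := (k + l).
Local Notation consistent := (consistent n k K Sn Tn En).

Let k_gt0 : 0 < k. Proof. by case: inst => [[]]. Qed.
Let card_S : #|S| = k. Proof. by case: inst => [_ []]. Qed.
Let card_T : #|T| = k. Proof. by case: inst => [_ []]. Qed.

Lemma instance_vertex : exists x : 'I_n, x \in S.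
Proof. by apply/card_gt0P; rewrite card_S. Qed.

Lemma slide_card (I J : {set 'I_n}) : slide I J -> #|J| = #|I|.
Proof.
by move=> [u [v [Iu Iv ->]]]; rewrite cardsU1 Iv [#|I|](cardsD1 u) Iu.
Qed.

(** Variables alive at a common time conflict, so their values form an independent set. Inclusion in
    [S] and in [T] is improved to equality by counting, as slides preserve cardinality. *)
Lemma yes_of_solution nxt y : plan_ok k l l nxt -> consistent nxt y ->
  (forall p, p < K -> y p < n) -> tjo_yes e S T k l.
Proof.
move=> [P1 P2] Hc yn; have [x0 _] := instance_vertex.
pose yo p : 'I_n := insubd x0 (y p).
have yoE p : p < K -> val (yo p) = y p by move=> pK; rewrite val_insubd yn.
(* The variables holding tokens after [j] moves: already introduced and replaced only later. *)
pose alive j p := (p < k + j) && (k + j <= nxt p).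
pose I j := [set yo (val p) | p : 'I_K & alive j (val p)].
have inI j x : j <= l -> reflect (exists2 p, alive j p & x = yo p) (x \in I j).
  move=> jl; apply: (iffP imsetP) => [[p Hp ->]|[p Hp ->]].
    by exists (val p) => //; rewrite inE in Hp.
  have pK : p < K by case/andP: Hp; lia.
  by exists (Ordinal pK); rewrite ?inE.
have sep j p q : j <= l -> alive j p -> alive j q -> p != q ->
    yo p != yo q /\ ~~ e (yo p) (yo q).
  move=> jl /andP [p1 p2] /andP [q1 q2] pq.
  have [pK qK] : p < K /\ q < K by lia.
  have [_ _ /(_ p pK pq (yn p pK))] := Hc q qK (yn q qK).
  rewrite -!yoE // EnE -val_eqE; apply.
  by rewrite /conflict; lia.
have Is j : j < l -> slide (I j) (I j.+1).
  move=> jl; have [r [r1 r2 r3]] := P2 j jl.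
  have ar : alive j r by rewrite /alive r1 r2 leqnn.
  have av : alive j.+1 (k + j).
    rewrite /alive; have : k + j < K by lia.
    by move/P1; lia.
  have aS p : p < K -> p != k + j -> alive j.+1 p = alive j p && (p != r).
    move=> pK pj; rewrite /alive; apply/idP/idP.
      move=> /andP [p1 p2]; apply/andP; split; first by lia.
      by apply: contraTneq p2 => ->; rewrite r2; lia.
    move=> /andP [/andP [p1 p2] pr]; apply/andP; split; first by lia.
    have : nxt p != k + j by apply: contraNneq pr => /(r3 p pK) ->.
    by lia.
  have aK j' p : j' <= l -> alive j' p -> p < K by move=> j'l /andP [H _]; lia.
  exists (yo r), (yo (k + j)); split.
  - by apply/inI; [exact: ltnW|exists r].
  - rewrite !inE negb_and negbK; case: eqP => //= /eqP ne.
    apply/negP => /(inI _ _ (ltnW jl)) [p ap E].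
    have pj : p != k + j by case/andP: ap; lia.
    have pr : p != r by apply: contraNneq ne => <-; rewrite E.
    have ap' : alive j.+1 p by rewrite (aS p (aK j p (ltnW jl) ap) pj) ap pr.
    by have [] := sep j.+1 p (k + j) jl ap' av pj; rewrite E eqxx.
  - apply/setP => x; rewrite in_setU1 in_setD1; apply/idP/idP.
      move=> /(inI _ _ jl) [p ap ->].
      case: (p =P k + j) => [->|/eqP pj]; first by rewrite eqxx.
      move: (ap); rewrite (aS p (aK j.+1 p jl ap) pj) => /andP [{}ap pr].
      have [-> _] := sep j p r (ltnW jl) ap ar pr; rewrite /= orbC.
      by have -> : yo p \in I j by apply/inI; [exact: ltnW|exists p].
    move=> /orP [/eqP ->|/andP [xr /(inI _ _ (ltnW jl)) [p ap E]]].
      by apply/inI => //; exists (k + j).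
    have pj : p != k + j by case/andP: ap; lia.
    have pr : p != r by apply: contraNneq xr => <-; rewrite E.
    apply/inI => //; exists p => //.
    by rewrite (aS p (aK j p (ltnW jl) ap) pj) ap pr.
have I0 : I 0 = S.
  apply/eqP; rewrite eqEcard; apply/andP; split.
    apply/subsetP => x /(inI _ _ (leq0n l)) [p /andP [p1 _] ->].
    have pk : p < k by lia.
    have pK : p < K by lia.
    have [H _ _] := Hc p pK (yn p pK).
    by have := H pk; rewrite -yoE // SnE.
  (* The variables below [k] are all alive at time 0 and have distinct values, so at least [k]
     vertices occur. *)
  rewrite card_S card_in_imset.
    have ck : #|[set lshift l i | i : 'I_k]| = k.
      by rewrite card_imset ?card_ord //; apply: lshift_inj.
    rewrite -[X in X <= _]ck; apply: subset_leq_card.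
    apply/subsetP => p /imsetP [i _ ->].
    rewrite inE /alive addn0 /= ltn_ord /=.
    have : i < K by have := ltn_ord i; lia.
    by move/P1; lia.
  move=> p q; rewrite !inE => ap aq E; apply: val_inj; apply/eqP.
  apply: contraT => ne; have [] := sep 0 p q (leq0n l) ap aq ne.
  by rewrite E eqxx.
have Ic j : j <= l -> #|I j| = k.
  elim: j => [|j IH] jl; first by rewrite I0.
  by rewrite (slide_card (Is j jl)) IH // ltnW.
have Il : I l = T.
  apply/eqP; rewrite eqEcard card_T Ic // leqnn andbT.
  apply/subsetP => x /(inI _ _ (leqnn l)) [p /andP [p1 p2] ->].
  have [_ H _] := Hc p p1 (yn p p1).
  by have := H p2; rewrite -yoE // TnE.
have [|p [A1 A2 A3 A4]] := @compress_slides n e k l I Is.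
  move=> j jl; rewrite Ic // eqxx andbT.
  apply/forallP => x; apply/implyP => /(inI _ _ jl) [p ap ->].
  apply/forallP => z; apply/implyP => /(inI _ _ jl) [q aq ->].
  case: (p =P q) => [->|/eqP pq]; first by rewrite e_irr.
  by have [] := sep j p q jl ap aq pq.
by exists p; rewrite -I0; split; rewrite ?A3.
Qed.

(** The plan is read off the sequence move by move. In the invariant [nxt p = K] means not replaced
    so far, and such variables hold exactly the current tokens. *)
Lemma solution_of_yes nxt0 : (forall q, q < K -> nxt0 q = K) ->
  tjo_yes e S T k l ->
  exists ds ys, [/\ size ds = l, all (fun g => g < K) ds,
    (plan k K nxt0 ds).2 = false,
    consistent (plan k K nxt0 ds).1.2 ys
    & forall p, p < K -> ys p < n].
Proof.
move=> H0 /(slides_of_yes k_gt0) [I [I0 Il Is Ig]].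
have [x0 _] := instance_vertex.
have main : forall j, j <= l -> exists ds (y : nat -> 'I_n),
  let nxt := (plan k K nxt0 ds).1.2 in
  [/\ size ds = j, all (fun g => g < K) ds, (plan k K nxt0 ds).2 = false,
    forall v, v \in I j <-> exists p, [/\ p < k + j, nxt p = K & y p = v]
  & (forall p, p < k -> y p \in S) /\
    forall p q, p < k + j -> q < k + j -> p != q -> conflict nxt p q ->
      y p != y q /\ ~~ e (y p) (y q)].
  elim=> [|j IH] jl.
    exists [::], (fun p => nth x0 (enum S) p) => nxt.
    have sS : size (enum S) = k by rewrite -cardE.
    have yS p : p < k -> nth x0 (enum S) p \in S.
      by move=> pk; rewrite -mem_enum mem_nth ?sS.
    split=> //.
      rewrite I0 => v; split=> [vS|[p [pk _ <-]]]; last by apply: yS; rewrite addn0 in pk.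
      exists (index v (enum S)).
      have iv : index v (enum S) < k by rewrite -sS index_mem mem_enum.
      by split; [rewrite addn0|apply: H0; lia|rewrite nth_index ?mem_enum].
    split=> // p q; rewrite addn0 => pk qk pq _; split.
      by rewrite nth_uniq ?sS ?enum_uniq.
    have [[_ _ iS _] _] := inst.
    by move/forall_inP/(_ _ (yS p pk))/forall_inP/(_ _ (yS q qk)): iS.
  have [ds [y [D1 D2 D3 D4 [D5 D6]]]] := IH (ltnW jl).
  have [u [v [Iu Iv EI]]] := Is j jl.
  have dsl : size ds <= l by rewrite D1 ltnW.
  have := plan_inv H0 dsl.
  have Ep g : plan k K nxt0 (rcons ds g) = plan_step K (plan k K nxt0 ds) g.
    by rewrite /plan -cats1 foldl_cat.
  move: D3 D4 D6 Ep; rewrite D1.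
  case: (plan k K nxt0 ds) => [[p0 nxt] fail] /= -> D4 D6 Ep [p0E /(_ erefl) ok].
  (* [r] is the variable holding the token that leaves; it becomes the next digit of the plan. *)
  have [r [r1 r2 r3]] := (D4 u).1 Iu.
  have [P1 P2] := plan_ok_upd jl ok r1 r2.
  have [Q1 Q2] := ok.
  pose y' p := if p == k + j then v else y p.
  exists (rcons ds r), y'; rewrite Ep p0E r1 r2 leqnn /=.
  have jK : k + j < K by lia.
  have nj : nxt (k + j) = K by case: (Q1 _ jK); lia.
  have rj : r == k + j = false by lia.
  have yold p : p < k + j -> y' p = y p by move=> pj; rewrite /y' ifN //; lia.
  have ynew : y' (k + j) = v by rewrite /y' eqxx.
  have aI p : p < k + j -> nxt p = K -> p != r -> y p \in I j :\ u.
    move=> pj pK pr; rewrite in_setD1 -r3.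
    have -> : y p \in I j by apply/D4; exists p.
    by have [] := D6 p r pj r1 pr; rewrite ?andbT // /conflict pK r2; lia.
  split.
  - by rewrite size_rcons D1.
  - by rewrite all_rcons D2 andbT; lia.
  - by [].
  - move=> w; rewrite EI in_setU1; split.
      move=> /orP [/eqP ->|].
        by exists (k + j); rewrite updE eq_sym rj; split=> //; lia.
      rewrite in_setD1 => /andP [wu /D4 [p [p1 p2 p3]]].
      exists p; rewrite updE yold // p3 p2; split=> //; first by lia.
      by case: eqP => // Epr; move: wu; rewrite -p3 Epr r3 eqxx.
    move=> [p [p1 p2 p3]]; move: p2; rewrite updE.
    case: eqP => [_|/eqP pr]; first by lia.
    move=> pK; case: (p =P k + j) => [Epj|/eqP pj].
      by rewrite -p3 Epj ynew eqxx.
    by rewrite -p3 yold; [rewrite aI ?orbT //; lia|lia].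
  - split=> [p pk|]; first by rewrite yold; [exact: D5|lia].
    have new p : p < k + j -> conflict (upd nxt r (k + j)) p (k + j) ->
        v != y p /\ ~~ e v (y p).
      move=> pj /andP [c1 c2].
      have pr : p != r by apply: contraTneq c1 => ->; rewrite updE eqxx ltnn.
      have pK : nxt p = K.
        by move: c1; rewrite updE (negbTE pr); case: (Q1 p); lia.
      have yI := aI p pj pK pr; split; first by apply: contraNneq Iv => ->.
      have /andP [iI _] := Ig j.+1 jl.
      move/forall_inP: iI => /(_ v); rewrite EI in_setU1 eqxx => /(_ isT).
      by move/forall_inP => /(_ (y p)); rewrite in_setU1 yI orbT; apply.
    move=> p q p1 q1 pq cf.
    case: (p =P k + j) => [Epj|/eqP pj].
      rewrite Epj ynew yold; last by lia.
      by apply: new; [lia|move: cf; rewrite conflictC Epj].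
    case: (q =P k + j) => [Eqj|/eqP qj].
      rewrite Eqj ynew yold; last by lia.
      rewrite eq_sym e_sym; by apply: new; [lia|move: cf; rewrite Eqj].
    rewrite !yold; try lia.
    apply: D6 => //; try lia.
    (* Replacing a variable shortens its interval, so conflicts between older variables were present
       before and the induction hypothesis covers them. *)
    have le z : upd nxt r (k + j) z <= nxt z.
      by rewrite updE; case: eqP => // ->; lia.
    by move: cf (le p) (le q); rewrite /conflict; lia.
have [ds [y [D1 D2 D3 D4 [D5 D6]]]] := main l (leqnn l).
exists ds, (fun p => y p); split=> //.
have dsl : size ds <= l by rewrite D1.
have := plan_inv H0 dsl.
move: D3 D4 D6; rewrite D1.
case: (plan k K nxt0 ds) => [[p0 nxt] fail] /= -> D4 D6 [p0E /(_ erefl) [P1 _]].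
move=> p pK _; split=> [pk|pn|q qK qp _ cf].
- by rewrite SnE D5.
- rewrite TnE -Il; apply/D4; exists p; split=> //.
  by case: (P1 p pK); lia.
- by rewrite EnE; apply: D6 => //; rewrite conflictC.
Qed.

Let En_sym x y : x < n -> y < n -> En x y = En y x.
Proof.
by move=> xn yn; rewrite -[x]/(val (Ordinal xn)) -[y]/(val (Ordinal yn)) !EnE e_sym.
Qed.

Lemma transversal_of_degenerate d B : degenerate e d -> d.+1 * K <= B ->
  transversal_bound n K En B.
Proof.
move=> De HB L Lu Ln U Uu UK HL; have [x0 _] := instance_vertex.
pose Ls p := [set v : 'I_n | val v \in L p].
have sU : size U <= K.
  rewrite -[K](size_iota 0); apply: uniq_leq_size => // p /UK pK.
  by rewrite mem_iota.
have cL p : p \in U -> size (L p) <= #|Ls p|.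
  move=> pU; have pK := UK p pU.
  have i0 z : z \in L p -> val (insubd x0 z : 'I_n) = z.
    by move=> zL; rewrite val_insubd (Ln p z pK zL).
  have us : uniq [seq (insubd x0 z : 'I_n) | z <- L p].
    rewrite map_inj_in_uniq ?Lu // => a b aL bL E.
    by rewrite -(i0 a aL) -(i0 b bL) E.
  rewrite -(size_map (fun z => insubd x0 z : 'I_n)) -(card_uniqP us).
  apply: subset_leq_card; apply/subsetP => v /mapP [z zL ->].
  by rewrite inE i0.
have [p pU|y [y1 y2]] := @degenerate_transversal n e d x0 U Ls e_sym De Uu.
  apply: leq_trans (cL p pU); apply: leq_trans (HL p pU); apply: leq_trans HB.
  by rewrite leq_mul2l sU orbT.
exists (fun p => val (y p)); split=> [p /y1|p q pU qU pq]; first by rewrite inE.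
by rewrite EnE; apply: y2.
Qed.

(** * Correctness of a single base *)

Section Sim.
Variables (nxt0 y0 : nat -> nat).
Hypothesis nxt0E : forall q, q < K -> nxt0 q = K.
Hypothesis y0E : forall q, q < K -> y0 q = n.

Definition run (B W : nat) : (nat -> nat) * bool * bool :=
  sim n k K Sn Tn En B nxt0 y0 (digits B 0 l W) (digits B l K W).

Let unassigned0 : size (unassigned n K y0) = K.
Proof.
rewrite -[RHS](size_iota 0) /unassigned; congr size; apply/all_filterP.
by apply/allP => p; rewrite mem_iota => /y0E ->.
Qed.

Let consistent0 nxt : consistent nxt y0.
Proof. by move=> p pK; rewrite y0E ?ltnn. Qed.

Lemma run_sound B W : (run B W).1.2 = false -> tjo_yes e S T k l.
Proof.
rewrite /run /sim; set ds := digits B 0 l W.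
have := plan_inv nxt0E (_ : size ds <= l); rewrite size_digits => /(_ (leqnn l)).
case: (plan _ _ _ _) => [[p nxt] [|]] [_ ok] /=; first by rewrite rounds_fail.
move=> Hf; have [|H1 H2] := rounds_sound En_sym (consistent0 nxt) Hf.
  by rewrite size_digits unassigned0.
exact: yes_of_solution (ok erefl) H1 H2.
Qed.

Lemma run_complete B : K < B -> tjo_yes e S T k l ->
  exists2 W, W < B ^ (l + K) & (run B W).1.2 = false \/ (run B W).2.
Proof.
move=> KB /(solution_of_yes nxt0E) [ds1 [ys [D1 D2 D3 Hc ysn]]].
have B0 : 0 < B by apply: leq_ltn_trans KB.
have Hx : extends n K y0 ys by move=> q qK; rewrite y0E ?ltnn.
have [ds2 [F1 F2 F3]] := rounds_complete B0 Hc ysn Hx.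
(* Plan digits are below [K], hence valid digits in base [B]. *)
have D2' : all (fun g => g < B) ds1.
  by apply: sub_all D2 => g /= gK; apply: ltn_trans KB.
have [W HW [W1 W2]] := digits_surj2 D2' F2.
rewrite D1 F1 unassigned0 in HW W1 W2.
by exists W => //; rewrite /run W1 W2 /sim D3.
Qed.

(** The new branch number keeps the plan digits of [W] and changes only the branching digits. *)
Lemma run_of_trunc d B W : degenerate e d -> K < B -> d.+1 * K <= B ->
  (run B W).2 -> exists2 W', W' < B ^ (l + K) & (run B W').1.2 = false.
Proof.
move=> De KB HB; rewrite /run /sim.
have B0 : 0 < B by apply: leq_ltn_trans KB.
case Ef : (plan k K nxt0 (digits B 0 l W)).2; first by rewrite rounds_fail.
have TB := transversal_of_degenerate De HB.
move=> /(rounds_of_trunc En_sym B0 TB (consistent0 _)).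
rewrite size_digits unassigned0 => /(_ erefl (digits_lt _ _ _ B0)) [ds [H1 H2 H3]].
have [W' HW [W1 W2]] := digits_surj2 (digits_lt 0 l W B0) H2.
rewrite size_digits H1 in HW W1 W2.
by exists W' => //; rewrite /run /sim W1 W2 Ef.
Qed.

Lemma run_short B W : n < B -> (run B W).2 = false.
Proof. exact: rounds_short. Qed.

End Sim.
End Graph.

(** * The main loop *)

Lemma has_iotaS a i : has a (iota 0 i.+1) = has a (iota 0 i) || a i.
Proof. by rewrite iota_rcons has_rcons orbC. Qed.

Section Main.
Variables (n k l : nat) (S T : nat -> bool) (E : nat -> nat -> bool).
Variables (gN gY : nat -> nat).
Local Notation K := (k + l).
Local Notation L := (l + K).
Local Notation env := (env n k K S T E).

(* The cells of the arrays [vNXT] and [vY] beyond [K] are never written, but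
   hold arbitrary values [gN] and [gY]. *)
Let nxt0 p := if p < K then K else gN p.
Let y0 p := if p < K then n else gY p.
Local Notation attempt := (run n k l S T E nxt0 y0).

Definition found (B : nat) : bool :=
  has (fun W => ~~ (attempt B W).1.2) (iota 0 (B ^ L)).

Definition truncated (B : nat) : bool :=
  has (fun W => (attempt B W).2) (iota 0 (B ^ L)).

Definition ready (s : store) : Prop :=
  [/\ env s, s vL 0 = l, s vLN 0 = L
    & forall p, K <= p -> s vNXT p = gN p /\ s vY p = gY p].

Lemma ready_den c s :
  all (fun j => j \notin mods c) (vL :: vLN :: vNXT :: vY :: env_vars) ->
  ready s -> ready (den c s).
Proof.
move=> /= /and5P [H1 H2 H3 H4 H5] [R1 R2 R3 R4].
by split; rewrite ?frame //; apply: env_den.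
Qed.

(** When no variable is left, [best] returns index [K], but the accompanying value [n] blocks the
    write. *)
Lemma rounds_high B nxt st ds q : K <= q ->
  (foldl (round n k K S T E B nxt) st ds).1.1 q = st.1.1 q.
Proof.
move=> Kq; elim: ds st => // g ds IH [[y fail] tr]; rewrite foldl_cons IH.
rewrite /round; case: (fail) => //.
have := bestP n k S T E nxt y g (leqnn K).
case: (best _ _ _ _ _ _ _ _ _ _) => [[b c] v] H /=.
case: ifP => // vn; rewrite updE; case: eqP => // Eq.
by case: H => [[_ [_ _ Ev]]|[bK _ _ _ _]]; lia.
Qed.

Lemma scan_body_spec s (t r : bool) : ready s -> 0 < s vB 0 ->
  s vW 0 <= s vCNT 0 -> s vTR 0 = t -> s vRES 0 = r -> s vDONE 0 = r ->
  let st := attempt (s vB 0) (s vW 0) in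
  [/\ ready (den scan_body s), den scan_body s vW 0 = (s vW 0).+1,
      den scan_body s vTR 0 = t || st.2,
      den scan_body s vRES 0 = r || ~~ st.1.2
    & den scan_body s vDONE 0 = r || ~~ st.1.2].
Proof.
move=> [He HL HLN Hg] HB HW HT HR HD st.
rewrite /scan_body den_seq.
have := sim_spec He HL HB HW HT.
have -> : (fun p => if p < K then K else s vNXT p) = nxt0.
  by apply: functional_extensionality => p; rewrite /nxt0; case: ltnP => // /Hg [].
have -> : (fun p => if p < K then n else s vY p) = y0.
  by apply: functional_extensionality => p; rewrite /y0; case: ltnP => // /Hg [].
rewrite -/(run _ _ _ _ _ _ _ _ _ _) -/st.
move=> [F1 T1 N1 Y1].
have F j : j \notin mods sim_com -> den sim_com s j = s j by apply: frame.
have He1 : env (den sim_com s) by apply: env_den.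
move: (F vL isT) (F vLN isT) (F vW isT) (F vRES isT) (F vDONE isT) He1 F1 T1 N1 Y1.
move: (den sim_com s) => s1 FL FLN FW FR FD He1 F1 T1 N1 Y1.
have R1 : ready s1.
  split=> //; rewrite ?FL ?FLN // => p Kp.
  rewrite N1 Y1 plan_high ?size_digits // /st /run /sim rounds_high //.
  by rewrite /= /nxt0 /y0 ltnNge Kp.
split; first exact: ready_den.
- by rewrite den_seq /= /sset /= F1; case: (_.1.2); rewrite /= FW addn1.
- by rewrite den_seq /= /sset /= F1; case: (_.1.2); rewrite /= T1.
- by rewrite den_seq /= /sset /= F1; case: (_.1.2); rewrite /= ?orbT ?orbF ?FR.
- by rewrite den_seq /= /sset /= F1; case: (_.1.2); rewrite /= ?orbT ?orbF ?FD.
Qed.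

Lemma scan_spec s : ready s -> 0 < s vB 0 -> s vCNT 0 = s vB 0 ^ L ->
  s vW 0 = 0 -> s vTR 0 = 0 -> s vRES 0 = 0 -> s vDONE 0 = 0 ->
  [/\ ready (den scan_com s), den scan_com s vB 0 = s vB 0,
      den scan_com s vRES 0 = found (s vB 0)
    & den scan_com s vDONE 0 = found (s vB 0) || ~~ truncated (s vB 0)].
Proof.
move=> R HB HC HW HT HR HD; rewrite /scan_com den_seq.
have := @for_inv (fun i s' =>
   let r := has (fun W => ~~ (attempt (s vB 0) W).1.2) (iota 0 i) in
   [/\ ready s', s' vW 0 = i,
       s' vTR 0 = has (fun W => (attempt (s vB 0) W).2) (iota 0 i)
     & s' vRES 0 = r /\ s' vDONE 0 = r]) vCNT scan_body s.
case; first by [].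
  move=> i s' Hi F [R' W' T' [R1 R2]].
  have FB : s' vB 0 = s vB 0 by rewrite F.
  have FC : s' vCNT 0 = s vCNT 0 by rewrite F.
  have [||A1 A2 A3 A4 A5] := @scan_body_spec s' _ _ R' _ _ T' R1 R2.
  - by rewrite FB.
  - by rewrite W' FC ltnW.
  move: A2 A3 A4 A5; rewrite FB W' => A2 A3 A4 A5.
  by rewrite !has_iotaS; split.
have FB : den (For vCNT scan_body) s vB = s vB by rewrite frame.
move: FB; move: (den (For vCNT scan_body) s) => s1 FB.
rewrite HC => R1 _ T1 [Re1 D1].
have -> : den (If (var vTR) Skip (asg vDONE (Cst 1))) s1 vDONE 0 =
    found (s vB 0) || ~~ truncated (s vB 0).
  by rewrite /= T1 -/(truncated _); case: (truncated _); rewrite /= ?orbT ?orbF.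
by split; [apply: ready_den|rewrite frame // FB|rewrite frame|].
Qed.

Lemma setup_spec s : ready s ->
  [/\ ready (den setup_com s), den setup_com s vB 0 = (s vB 0).+1,
      den setup_com s vCNT 0 = (s vB 0).+1 ^ L
    & den setup_com s vW 0 = 0 /\ den setup_com s vTR 0 = 0].
Proof.
move=> R; split; first exact: ready_den.
- rewrite /setup_com /reset_com den_seq frame // /= /sset /=; exact: addn1.
- rewrite /setup_com /reset_com !den_seq.
  set s1 := den (asg vCNT (Cst 1)) _.
  have B1 : s1 vB 0 = (s vB 0).+1 by rewrite /s1 /= /sset /= addn1.
  have L1 : s1 vLN 0 = L by case: R.
  rewrite frame // frame //.
  have := @for_inv (fun i s' => s' vCNT 0 = (s vB 0).+1 ^ i) vLN power_body s1.
  rewrite L1; apply=> // i s' Hi F C'.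
  rewrite /power_body !den_seq.
  set s2 := den (asg vT (Cst 0)) s'.
  have B2 : s2 vB 0 = (s vB 0).+1 by rewrite -B1 -F.
  have := @for_inv (fun j s3 => s3 vT 0 = j * s' vCNT 0) vB addcnt s2.
  rewrite B2 /= /sset /= => ->; rewrite ?C' -?expnS //.
  move=> j s3 Hj F3 H.
  have C3 : s3 vCNT 0 = s' vCNT 0 by rewrite F3.
  by rewrite /= /sset /= H C3 C' mulSn addnC.
- by rewrite /setup_com /reset_com !den_seq; split; rewrite /= /sset.
Qed.

Lemma try_spec s : ready s -> s vDONE 0 = 0 -> s vRES 0 = 0 ->
  let B := (s vB 0).+1 in
  [/\ ready (den try_com s), den try_com s vB 0 = B,
      den try_com s vRES 0 = found B
    & den try_com s vDONE 0 = found B || ~~ truncated B].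
Proof.
move=> R HD HR; rewrite /try_com den_if.
have -> : (ev (var vDONE) s != 0) = false by rewrite /= HD.
rewrite den_seq; have [R1 B1 C1 [W1 T1]] := setup_spec R.
have D1 : den setup_com s vDONE 0 = 0 by rewrite frame.
have E1 : den setup_com s vRES 0 = 0 by rewrite frame.
move: (den setup_com s) R1 B1 C1 W1 T1 D1 E1 => s1 R1 B1 C1 W1 T1 D1 E1.
have [||R2 B2 E2 D2] := scan_spec R1 _ _ W1 T1 E1 D1; rewrite ?B1 //.
by rewrite B1 in B2 E2 D2.
Qed.

(** [cost_bound] cannot treat [try_com] as a whole, because the setup modifies the loop bounds [vB]
    and [vCNT]; it is applied to [reset_com] and [scan_com] separately. The bounds [L] and [vB] are
    dominated by the number of branches. *)
Lemma cost_try s Z : 0 < l -> ready s -> n <= Z -> 0 < Z ->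
  s vDONE 0 != 0 \/ 0 < s vB 0 /\ (s vB 0).+1 ^ L <= Z ->
  cost try_com s <= coef try_com * Z ^ deg try_com.
Proof.
move=> l0 R nZ Z0 HZ.
have small c : deg c <= deg try_com -> coef c * Z ^ deg c <= coef c * Z ^ deg try_com.
  by move=> Hd; rewrite leq_mul2l leq_pexp2l ?orbT.
have P0 : 0 < Z ^ deg try_com by rewrite expn_gt0 Z0.
have -> : cost try_com s = esize (var vDONE) + 2 +
    (if ev (var vDONE) s != 0 then 0
     else cost (incr vB) s + (cost reset_com (den (incr vB) s)
          + cost scan_com (den setup_com s))).
  by rewrite addnA.
have Ec : coef try_com = esize (var vDONE) + 2 + (coef (incr vB) +
    (coef reset_com + coef scan_com)).
  by [].
case: ifP => HD.
  rewrite addn0 Ec; move: (coef _ + _) P0 => a.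
  by move: (Z ^ _) => z P0; nia.
have {HZ}[B0 HZ] : 0 < s vB 0 /\ (s vB 0).+1 ^ L <= Z.
  by case: HZ => // H; move: HD; rewrite /= H.
have LZ : L <= Z.
  apply: leq_trans HZ; apply: ltnW; apply: ltn_expl; lia.
have BZ : (s vB 0).+1 <= Z.
  by apply: leq_trans HZ; rewrite -[X in X <= _]expn1 leq_pexp2l //; lia.
have [He HL HLN _] := R; have [HN _ HK] := env_vals He.
have c1 : cost (incr vB) s = coef (incr vB) by [].
have c2 : cost reset_com (den (incr vB) s) <= coef reset_com * Z ^ deg reset_com.
  apply: cost_bound => // x; rewrite !inE => /orP [/eqP ->|/eqP ->].
    by rewrite frame // HLN.
  by rewrite /= /sset /= addn1.
have [R1 B1 C1 _] := setup_spec R.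
have [He1 HL1 _ _] := R1; have [HN1 _ HK1] := env_vals He1.
have c3 : cost scan_com (den setup_com s) <= coef scan_com * Z ^ deg scan_com.
  apply: cost_bound => // x Hx.
  have : x \in [:: vCNT; vK; vL; vN].
    by move: x Hx; apply/allP.
  rewrite !inE => /or4P [] /eqP ->.
  - by rewrite C1.
  - by rewrite HK1; lia.
  - by rewrite HL1; lia.
  - by rewrite HN1.
have c2' := leq_trans c2 (small reset_com isT).
have c3' := leq_trans c3 (small scan_com isT).
rewrite Ec c1; move: c2' c3' P0.
move: (coef reset_com) (coef scan_com) (cost reset_com _) (cost scan_com _).
move: (coef (incr vB)) (esize _) (Z ^ deg try_com) => a b z c d e f.
by move=> *; nia.
Qed.

(** Apart from [K.+1], a base is tried only after its predecessor was truncated without success,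
    hence the form of the last hypothesis on [Z]. An undecided state after [n] iterations would mean
    truncation in base [K + n], which exceeds [n]. *)
Lemma main_loop_spec s Z : 0 < l -> 0 < n -> ready s ->
  s vB 0 = K -> s vDONE 0 = 0 -> s vRES 0 = 0 ->
  (forall B, n < B -> ~~ truncated B) ->
  n <= Z -> K.+1 ^ L <= Z ->
  (forall B, K < B -> truncated B -> ~~ found B -> B.+1 ^ L <= Z) ->
  (exists B, [/\ K < B, found B || ~~ truncated B
     & den (For vN try_com) s vRES 0 = found B]) /\
  cost (For vN try_com) s <= 10 + n * (coef try_com * Z ^ deg try_com + 4).
Proof.
move=> l0 n0 R HB HD HR Hshort nZ KZ HZ.
pose I i s' := ready s' /\
  ([/\ s' vDONE 0 = 0, s' vRES 0 = 0, s' vB 0 = K + i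
     & 0 < i -> truncated (K + i) /\ ~~ found (K + i)] \/
   s' vDONE 0 != 0 /\
   exists B, [/\ K < B, found B || ~~ truncated B & s' vRES 0 = found B]).
have inv i : I i (iter i (den try_com) s).
  elim: i => [|i [R' IH]]; first by split=> //; left; rewrite addn0.
  move: R' IH; rewrite iterS; move: (iter _ _ _) => s' R' [[D' E' B' H']|[D' HE]].
    have := try_spec R' D' E'; rewrite B' -addnS => -[R1 B1 E1 D1].
    split=> //; case Ef : (found (K + i.+1) || ~~ truncated (K + i.+1)).
      right; split; first by rewrite D1 Ef.
      by exists (K + i.+1); split=> //; lia.
    left; split=> //; first by rewrite D1 Ef.
      by rewrite E1; move: Ef; case: (found _).
    by move=> _; move: Ef; case: (found _) => //=; case: (truncated _).
  have ED : (ev (var vDONE) s' != 0) = true by rewrite /= D'.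
  have -> : den try_com s' = s' by rewrite /try_com den_if ED.
  by split=> //; right.
have HN : s vN 0 = n by have [He _ _ _] := R; case: (env_vals He).
split.
  have := inv n; rewrite den_for HN.
  move=> [_ [[D' E' B' H']|[_ //]]].
  by have [tr _] := H' n0; have := Hshort (K + n); rewrite tr; lia.
rewrite cost_for HN.
rewrite leq_add2l -[X in X * _]card_ord -sum_nat_const leq_sum // => i _.
rewrite leq_add2r; have [R' H] := inv i; apply: cost_try => //.
  by apply: leq_trans nZ.
case: H => [[_ _ B' H']|[D' _]]; last by left.
right; rewrite B'; split; first by lia.
case: (val i) H' => [_|j H']; first by rewrite addn0.
by have [|H1 H2] := H' _; last by apply: HZ => //; lia.
Qed.

End Main.

(** * Restoring the packed input, and the cost of the whole program *)

Lemma packed_rcons m rs i : packed m (rcons rs i) = (m i != 0) + 2 * packed m rs.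
Proof. by rewrite /packed -cats1 foldl_cat. Qed.

Lemma packed_lt m rs : packed m rs < 2 ^ size rs.
Proof.
elim/last_ind: rs => //= rs i IH.
by rewrite packed_rcons size_rcons expnS; case: (m i != 0); lia.
Qed.

Lemma packed_digit m rs j : j < size rs ->
  packed m (rev rs) %/ 2 ^ j %% 2 = (m (nth 0 rs j) != 0).
Proof.
elim: rs j => //= i rs IH j Hj; rewrite rev_cons packed_rcons.
set b := m i != 0; case: j Hj => [|j] Hj /=.
  by rewrite -/b expn0 divn1 mulnC addnC modnMDl; case: (b).
have -> : b + 2 * packed m (rev rs) = packed m (rev rs) * 2 + b by lia.
rewrite expnS divnMA divnMDl // (@divn_small b) ?addn0 ?IH //.
by case: (b).
Qed.

(** The bit in input cell [q] after unpacking, where [m] is the original memory: cell 3 is a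
    diagonal entry, cells 4 to 11 were packed, and the others were copied. *)
Definition cell_bit (s : store) (m : memory) (q : nat) : bool :=
  if q == 3 then false else if 3 < q < base then m q != 0 else s vIN q != 0.

Lemma unpack_spec s m : s vIN 3 = packed m [:: 11; 10; 9; 8; 7; 6; 5; 4] ->
  [/\ forall q, (den unpack_com s vIN q != 0) = cell_bit s m q
    & forall q, q < 3 -> den unpack_com s vIN q = s vIN q].
Proof.
move=> H3; rewrite /unpack_com !den_seq.
set s1 := den (asg vM (Cst 8)) _.
pose pk := packed m (rev (iota 4 8)).
have U1 : s1 vU 0 = pk by rewrite /s1 /= /sset /= H3.
have T1 : s1 vT 0 = pk by rewrite /s1 /= /sset /= H3.
have I1 : s1 vIN = s vIN by [].
have := @for_inv (fun i s' => [/\ s' vU 0 = pk %/ 2 ^ i, s' vI 0 = 4 + i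
   & forall q, s' vIN q = if 4 <= q < 4 + i then (m q != 0 : nat) else s vIN q])
   vM unpack_body s1.
case.
- by rewrite expn0 divn1; split=> // q; case: ifP => //; lia.
- move=> i s' Hi F [EU EI EN].
  have B' : s' vB 0 = 2 by rewrite F.
  have T' : s' vT 0 = pk by rewrite F.
  have [||U2 G2] := @divmod_spec vT s' isT; rewrite ?B' ?EU ?T' ?leq_div //.
  rewrite B' EU in U2 G2; rewrite /unpack_body den_seq.
  have FI : den (divmod vT) s' vI = s' vI by rewrite frame.
  have FN : den (divmod vT) s' vIN = s' vIN by rewrite frame.
  move: (den (divmod vT) s') U2 G2 FI FN => s2 U2 G2 FI FN.
  rewrite /= /sset /= U2 FI EI G2 -divnMA -expnSr addn1 addnS; split=> // q.
  rewrite packed_digit // FN EN nth_iota //.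
  by case: eqP => [->|ne]; [case: ifP => //; lia|
    congr (if _ then _ else _); lia].
move=> _ _; rewrite -[s1 vM 0]/8.
move: (den (For vM unpack_body) s1) => s2 EN; split=> q.
  rewrite /= /sset /= /cell_bit; case: (q == 3) => //; rewrite EN.
  by case: ifP => //; case: (m q != 0).
move=> Hq; rewrite /= /sset /= EN; case: eqP => [|_]; first by lia.
by case: ifP => //; lia.
Qed.

(** Constant, because eight packed bits stay below [2 ^ 8], and this bounds the divisions. *)
Lemma cost_unpack : exists X, forall s m,
  s vIN 3 = packed m [:: 11; 10; 9; 8; 7; 6; 5; 4] -> cost unpack_com s <= X.
Proof.
pose lp := For vM unpack_body.
exists (100 + coef lp * (2 ^ 8) ^ deg lp) => s m H3.
rewrite /unpack_com !cost_seq -/lp.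
set s1 := den (asg vM (Cst 8)) _.
have T1 : s1 vT 0 < 2 ^ 8.
  by rewrite /s1 /= /sset /= H3; apply: packed_lt.
have : cost lp s1 <= coef lp * (2 ^ 8) ^ deg lp.
  apply: cost_bound => // x; rewrite !inE => /orP [/eqP ->|/eqP ->] //.
  exact: ltnW.
move: (cost lp s1) (coef lp * _) => a b H.
set c := (X in _ + (_ + (_ + (_ + (_ + (_ + X)))))).
have -> : c = 10 by [].
by rewrite /=; lia.
Qed.

Lemma init_spec s (n := s vIN 0) (k := s vIN 1) (l := s vIN 2) :
  [/\ [/\ den init_com s vN 0 = n, den init_com s vKK 0 = k,
          den init_com s vL 0 = l, den init_com s vK 0 = k + l
        & den init_com s vLN 0 = l + (k + l)],
      forall x, x <= n.+1 -> den init_com s vROW x = x * n + 3,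
      den init_com s vB 0 = k + l, den init_com s vDONE 0 = 0
    & den init_com s vRES 0 = 0].
Proof.
rewrite /init_com !den_seq.
set s1 := den (asg vI (Cst 0)) _.
have N1 : s1 vN 0 = n by [].
have M1 : s1 vM 0 = n.+1 by rewrite /s1 /= /sset /= addn1.
have := @for_inv (fun i s' => s' vI 0 = i /\
   forall x, x <= i -> s' vROW x = x * n + 3) vM row_body s1.
rewrite M1; case.
- by split=> // x; rewrite leqn0 => /eqP ->.
- move=> i s' Hi F [EI ER]; have N' : s' vN 0 = n by rewrite F.
  rewrite /row_body /= /sset /= EI N' addn1; split=> // x Hx.
  case: eqP => [->|ne]; first by rewrite ER //; lia.
  by rewrite ER //; lia.
have F j : j \notin mods row_body -> den (For vM row_body) s1 j = s1 j.
  by move=> Hj; apply: frame.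
move: (F vN isT) (F vKK isT) (F vL isT) (F vK isT) (F vLN isT).
move: (den (For vM row_body) s1) => s2 F1 F2 F3 F4 F5 _ ER.
by rewrite /= /sset /= F1 F2 F3 F4 F5.
Qed.

Lemma cost_init : exists X, forall s, cost init_com s <= X * (s vIN 0).+1.
Proof.
pose lp := For vM row_body.
exists (200 + coef lp) => s.
rewrite /init_com !cost_seq -/lp.
set s1 := den (asg vI (Cst 0)) _.
have M1 : s1 vM 0 = (s vIN 0).+1 by rewrite /s1 /= /sset /= addn1.
have : cost lp s1 <= coef lp * (s vIN 0).+1 ^ deg lp.
  by apply: cost_bound => // x; rewrite inE => /eqP ->; rewrite M1.
rewrite expn1; move: (coef lp) (cost lp s1) => a b H.
by rewrite /=; nia.
Qed.

Lemma main_spec : exists C D, forall n k l (S T : nat -> bool)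
    (E : nat -> nat -> bool) (s : store) (m : memory) Z,
  0 < n -> 0 < l ->
  [/\ s vIN 0 = n, s vIN 1 = k, s vIN 2 = l
    & s vIN 3 = packed m [:: 11; 10; 9; 8; 7; 6; 5; 4]] ->
  (forall x v, x < n -> v < n -> cell_bit s m (x * n + 3 + v) = E x v) ->
  (forall v, v < n -> cell_bit s m (n * n + 3 + v) = S v) ->
  (forall v, v < n -> cell_bit s m (n.+1 * n + 3 + v) = T v) ->
  let found := found n k l S T E (s vNXT) (s vY) in
  let truncated := truncated n k l S T E (s vNXT) (s vY) in
  (forall B, n < B -> ~~ truncated B) ->
  n <= Z -> (k + l).+1 ^ (l + (k + l)) <= Z ->
  (forall B, k + l < B -> truncated B -> ~~ found B ->
     B.+1 ^ (l + (k + l)) <= Z) ->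
  (exists B, [/\ k + l < B, found B || ~~ truncated B
     & den main_com s vRES 0 = found B]) /\
  cost main_com s <= C * Z ^ D.
Proof.
have [X1 HX1] := cost_unpack; have [X2 HX2] := cost_init.
pose d := deg try_com; pose a := coef try_com.
exists (X1 + 2 * X2 + 14 + a), d.+1 => n k l S T E s m Z n0 l0.
move=> [E0 E1 E2 E3] HE HS HT found truncated Hs nZ KZ HZ.
rewrite /main_com (den_seq unpack_com) (den_seq init_com).
rewrite (cost_seq unpack_com) (cost_seq init_com).
have := HX1 s m E3; have [U1 U2] := unpack_spec E3.
have FU1 : den unpack_com s vNXT = s vNXT by rewrite frame.
have FU2 : den unpack_com s vY = s vY by rewrite frame.
move: (den unpack_com s) U1 U2 FU1 FU2 => s1 U1 U2 FU1 FU2 c1.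
have := HX2 s1; have := init_spec s1; rewrite !U2 // E0 E1 E2.
have FI1 : den init_com s1 vNXT = s vNXT by rewrite frame.
have FI2 : den init_com s1 vY = s vY by rewrite frame.
have FI3 : den init_com s1 vIN = s1 vIN by rewrite frame.
move: (den init_com s1) FI1 FI2 FI3 => s2 FI1 FI2 FI3.
move=> [[V1 V2 V3 V4 V5] V6 V7 V8 V9] c2.
have R : ready n k l S T E (s vNXT) (s vY) s2.
  split=> //; last by move=> p _; rewrite FI1 FI2.
  split=> //.
  - by move=> x v xn vn; rewrite FI3 U1 V6 ?HE //; lia.
  - by move=> v vn; rewrite FI3 U1 V6 ?HS //; lia.
  - by move=> v vn; rewrite FI3 U1 V6 ?HT //; lia.
have [H1 H2] := main_loop_spec l0 n0 R V7 V8 V9 Hs nZ KZ HZ.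
split; first exact: H1.
have Z0 : 0 < Z by apply: leq_trans nZ.
have Zd : 0 < Z ^ d by rewrite expn_gt0 Z0.
move: H2 c1 c2; rewrite -/d -/a expnS.
move: (cost _ s2) (cost _ s1) (cost _ s) (Z ^ d) Zd => x2 x1 x0 z Zd.
move: (a) => b; move=> h2 h1 h0.
have h3 : n * (b * z + 4) <= Z * (b * z + 4) by rewrite leq_mul2r nZ orbT.
have h4 : X2 * n.+1 <= X2 * (2 * Z) by rewrite leq_mul2l; apply/orP; right; lia.
have h5 : Z <= Z * z by rewrite leq_pmulr.
have h6 : X2 * Z <= X2 * (Z * z) by rewrite leq_mul2l h5 orbT.
have h7 : X1 <= X1 * (Z * z) by rewrite leq_pmulr // muln_gt0 Z0.
by nia.
Qed.

(** * The theorem *)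

Lemma size_enc_graph n (e : rel 'I_n) : size (enc_graph e) = n * n.
Proof. by rewrite size_allpairs !size_enum_ord. Qed.

Lemma size_enc_set n (A : {set 'I_n}) : size (enc_set A) = n.
Proof. by rewrite size_map size_enum_ord. Qed.

Lemma nth_enc_set n (A : {set 'I_n}) (v : 'I_n) : nth 0 (enc_set A) v = (v \in A).
Proof. by rewrite (nth_map v) ?size_enum_ord // nth_ord_enum. Qed.

Lemma nth_allpairs (X Y Z : Type) (f : X -> Y -> Z) z0 x0 y0 s t i j :
  i < size s -> j < size t ->
  nth z0 [seq f x y | x <- s, y <- t] (i * size t + j) =
  f (nth x0 s i) (nth y0 t j).
Proof.
elim: s i => //= x s IH [|i] Hi Hj; rewrite nth_cat size_map.
  by rewrite mul0n Hj (nth_map y0).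
by rewrite mulSn -addnA ltnNge leq_addr /= addKn IH.
Qed.

Lemma nth_enc_graph n (e : rel 'I_n) (u v : 'I_n) :
  nth 0 (enc_graph e) (u * n + v) = e u v.
Proof.
have := @nth_allpairs _ _ _ (fun x y => nat_of_bool (e x y)) 0 u u
   (enum 'I_n) (enum 'I_n) u v.
by rewrite !size_enum_ord !nth_ord_enum; apply.
Qed.

Section Encoding.
Variables (n k l : nat) (e : rel 'I_n) (S T : {set 'I_n}) (tail : seq nat).
Local Notation inp := (enc_inst e S T k l ++ tail).

Lemma enc_edge (u v : 'I_n) : nth 0 inp (u * n + 3 + v) = e u v.
Proof.
have -> : u * n + 3 + v = (u * n + v).+3 by lia.
rewrite /= nth_cat !size_cat size_enc_graph ifT; last first.
  have := ltn_ord u; have := ltn_ord v; nia.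
rewrite nth_cat size_enc_graph ifT ?nth_enc_graph //.
by have := ltn_ord u; have := ltn_ord v; nia.
Qed.

Lemma enc_source (v : 'I_n) : nth 0 inp (n * n + 3 + v) = (v \in S).
Proof.
have -> : n * n + 3 + v = (n * n + v).+3 by lia.
have vn := ltn_ord v.
rewrite /= nth_cat !size_cat size_enc_graph !size_enc_set ifT; last by lia.
rewrite nth_cat size_enc_graph ifF; last by lia.
by rewrite addKn nth_cat size_enc_set vn nth_enc_set.
Qed.

Lemma enc_target (v : 'I_n) : nth 0 inp (n.+1 * n + 3 + v) = (v \in T).
Proof.
have -> : n.+1 * n + 3 + v = (n * n + (n + v)).+3 by lia.
have vn := ltn_ord v.
rewrite /= nth_cat !size_cat size_enc_graph !size_enc_set ifT; last by lia.
rewrite nth_cat size_enc_graph ifF; last by lia.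
rewrite addKn nth_cat size_enc_set ifF; last by lia.
by rewrite addKn nth_enc_set.
Qed.
End Encoding.

Definition tjo_program : program :=
  prologue ++ ccode main_com 0 (size prologue)
  ++ [:: IConst 0 (base + vRES); ILoad 0 0; IHalt].

(** The arbitrary [tail] lets the same program accept both encodings. *)
Lemma tjo_program_spec : exists C D,
  forall n (e : rel 'I_n) (S T : {set 'I_n}) k l d (tail : seq nat) X,
  symmetric e -> irreflexive e -> tjo_instance e S T k l -> degenerate e d ->
  C * ((d.+1 * (k + l)).+1 ^ (l + (k + l)) * n) ^ D <= X ->
  exists m, exec tjo_program X 0 (init (enc_inst e S T k l ++ tail)) = Some m /\
    (accepts m <-> tjo_yes e S T k l).
Proof.
have [C [D HCD]] := main_spec.
(* The prologue takes at most [100 * n.+1 ^ 2] steps, bounded by 400 times a square, and the final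
   three instructions give 403; the square accounts for the 2 in the exponent. *)
exists (403 + C), (D + 2) => n e S T k l d tail X se ie inst De.
set M := (d.+1 * (k + l)).+1 ^ _ => HX.
have [[k0 l0 iS iT] [cS cT]] := inst.
have [x0 x0S] := instance_vertex inst.
have n0 : 0 < n by apply: leq_ltn_trans (ltn_ord x0).
pose inp := enc_inst e S T k l ++ tail.
(* Irreflexivity supplies the zero in address 3 from which the packing starts. *)
have I3 : nth 0 inp 3 = 0.
  by have := @enc_edge n k l e S T tail (Ordinal n0) (Ordinal n0); rewrite ie.
have [t [m [Ht Hr Hhi Hlo Hpk]]] :=
  runs_prologue (ccode main_com 0 (size prologue)
     ++ [:: IConst 0 (base + vRES); ILoad 0 0; IHalt]) I3.
have {}Hhi i : base <= i < n * (n + 2) + 3 ->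
    m (base + 32 * i) = nth 0 inp i by exact: Hhi.
have {}Ht : t <= 100 * n.+1 ^ 2 by exact: Ht.
(* Any memory represents a store; cells not yet written hold leftovers of the input, so the plan and
   assignment arrays start with arbitrary contents. *)
pose s : store := fun j i => m (base + 32 * i + j).
have Rs : represents s m by [].
have s0 i : s vIN i = m (base + 32 * i) by rewrite /s addn0.
have bit q : 2 < q < n * (n + 2) + 3 -> cell_bit s (init inp) q = (nth 0 inp q != 0).
  move=> Hq; rewrite /cell_bit; case: eqP => [->|q3]; first by rewrite I3.
  by case: ifP => // Hq'; rewrite s0 Hhi //; lia.
pose Sn v := nth 0 inp (n * n + 3 + v) != 0.
pose Tn v := nth 0 inp (n.+1 * n + 3 + v) != 0.
pose En x v := nth 0 inp (x * n + 3 + v) != 0.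
have SnE (v : 'I_n) : Sn v = (v \in S) by rewrite /Sn enc_source; case: (v \in S).
have TnE (v : 'I_n) : Tn v = (v \in T) by rewrite /Tn enc_target; case: (v \in T).
have EnE (u v : 'I_n) : En u v = e u v by rewrite /En enc_edge; case: (e u v).
have M0 : 0 < M by rewrite expn_gt0.
have L0 : 0 < l + (k + l) by rewrite addn_gt0 l0.
have nxtE q : q < k + l -> (if q < k + l then k + l else s vNXT q) = k + l by move->.
have yE q : q < k + l -> (if q < k + l then n else s vY q) = n by move->.
have [||||||||[B [KB HB RB]] Hc] :=
  HCD n k l Sn Tn En s (init inp) (M * n) n0 l0.
- by rewrite !s0 Hpk !Hlo.
- by move=> x v xn vn; rewrite bit //; nia.
- by move=> v vn; rewrite bit //; nia.
- by move=> v vn; rewrite bit //; nia.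
- by move=> B nB; rewrite /truncated -all_predC; apply/allP => W _ /=; rewrite run_short.
- by rewrite leq_pmull.
- apply: leq_trans (_ : M <= _); last by rewrite leq_pmulr.
  by rewrite /M leq_exp2r // ltnS leq_pmull.
- move=> B KB /hasP [W _ tr] nf.
  (* From [d.+1 * (k + l)] on, truncation in one branch forces success in another, so an
     unsuccessful truncated base is smaller and its successor is still covered by [M]. *)
  have Bd : B < d.+1 * (k + l).
    rewrite ltnNge; apply: contra nf => dB.
    have [W' HW' ok] := run_of_trunc se inst EnE yE De KB dB tr.
    by apply/hasP; exists W'; rewrite ?mem_iota ?ok.
  apply: leq_trans (_ : M <= _); last by rewrite leq_pmulr.
  by rewrite /M leq_exp2r // ltnW // ltnS.
have [|m' [Em' V']] := @exec_ccode prologue main_com vRES X 0 (init inp) s m t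
   cwf_main isT Hr Rs.
  apply: leq_trans HX; move: Hc Ht; set Zb := M * n.
  have nZ : n <= Zb by rewrite leq_pmull.
  have Z0 : 0 < Zb by apply: leq_trans nZ.
  have ZD : 0 < Zb ^ D by rewrite expn_gt0 Z0.
  have n2 : n.+1 ^ 2 <= 4 * Zb ^ 2.
    by rewrite -(leq_exp2r _ _ (isT : 0 < 2)) in nZ *; nia.
  have Z2 : 0 < Zb ^ 2 by rewrite expn_gt0 Z0.
  rewrite expnD; move: (cost _ _) (Zb ^ D) ZD (Zb ^ 2) Z2 (n.+1 ^ 2) n2.
  move=> x z z0 w w0 v vw cx tv.
  have h1 : w <= z * w by rewrite leq_pmull.
  have h2 : C * z <= C * (z * w) by rewrite leq_mul2l leq_pmulr ?orbT.
  by rewrite mulnDl; lia.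
exists m'; split; first exact: Em'.
rewrite /accepts V' RB eqb0 negbK; split=> [/hasP [W _ ok]|yes].
  apply: (run_sound se ie inst SnE TnE EnE nxtE yE (B := B) (W := W)).
  exact: negbTE.
have [W HW [ok|tr]] := run_complete se inst SnE TnE EnE nxtE yE KB yes.
  by apply/hasP; exists W; rewrite ?mem_iota ?ok.
case/orP: HB => // /hasPn /(_ W); rewrite mem_iota add0n => /(_ HW).
by rewrite tr.
Qed.

(** A double exponential dominates the parameter part of the running time and can be computed by two
    doubling loops, without multiplication. *)
Definition tower_com (c : nat) : com :=
  asg 1 (Plus (Plus (var 0) (var 0)) (Cst c)) ;; asg 2 (Cst 1) ;;
  For 1 (asg 2 (Plus (var 2) (var 2))) ;; asg 3 (Cst 1) ;;
  For 2 (asg 3 (Plus (var 3) (var 3))).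

Lemma double_spec x y s : x != y -> s y 0 = 1 ->
  den (For x (asg y (Plus (var y) (var y)))) s y 0 = 2 ^ s x 0.
Proof.
move=> xy y1.
have := @for_inv (fun i s' => s' y 0 = 2 ^ i) x (asg y (Plus (var y) (var y))) s.
apply=> // i s' _ _ H.
by rewrite /= /sset !eqxx /= H expnS mul2n addnn.
Qed.

Lemma tower_computable c : ram_computable (fun x => 2 ^ (2 ^ (x + x + c))).
Proof.
pose pre := [:: IConst 1 base; IStore 1 0].
exists (pre ++ ccode (tower_com c) 0 (size pre)
        ++ [:: IConst 0 (base + 3); ILoad 0 0; IHalt]) => x.
pose m0 := init [:: x]; pose m := upd (upd m0 1 base) base x.
pose s : store := fun j i => m (base + 32 * i + j).
have R : runs (pre ++ ccode (tower_com c) 0 (size pre)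
    ++ [:: IConst 0 (base + 3); ILoad 0 0; IHalt]) 0 m0 2 (size pre) m by [].
have [m' [Em V]] := exec_ccode (s := s) (isT : cwf (tower_com c) 0)
  (isT : 3 < 32) R (fun j i _ => erefl) (leqnn _).
exists (2 + cost (tower_com c) s + 3), m'; split; first exact: Em.
rewrite V {V Em R} /tower_com !den_seq.
set s1 := den (asg 2 (Cst 1)) _.
have E1 : s1 1 0 = x + x + c by [].
set s2 := den (For 1 _) s1.
have E2 : s2 2 0 = 2 ^ (x + x + c) by rewrite -E1; apply: double_spec.
set s3 := den (asg 3 (Cst 1)) s2.
have E3 : s3 2 0 = s2 2 0 by rewrite /s3 frame.
by rewrite -E2 -E3; apply: double_spec.
Qed.

Lemma tower_bound C D : exists c, forall k l d,
  C * ((d.+1 * (k + l)).+1 ^ (l + (k + l))) ^ D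
    <= 2 ^ (2 ^ (k + l + d + (k + l + d) + c)).
Proof.
(* The parameter part is at most [2 ^ (C + 4 * x ^ 2 * D)]. In the outer exponent [x + x] absorbs
   the square, [D] and [C] absorb themselves, and 3 yields a factor 8 for the coefficient 4 and the
   sum. *)
exists (3 + D + C) => k l d; set x := k + l + d.
have xx : x < 2 ^ x by apply: ltn_expl.
have h1 : (d.+1 * (k + l)).+1 <= 2 ^ (x + x).
  apply: (@leq_trans (x.+1 * x.+1)); first by rewrite /x; nia.
  by rewrite expnD leq_mul.
have h2 : (d.+1 * (k + l)).+1 ^ (l + (k + l)) <= 2 ^ ((x + x) * (x + x)).
  rewrite expnM; apply: (@leq_trans ((2 ^ (x + x)) ^ (l + (k + l)))).
    by case: (posnP (l + (k + l))) => [->//|H]; rewrite leq_exp2r.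
  by rewrite leq_pexp2l ?expn_gt0 //; rewrite /x; lia.
have h3 : C * ((d.+1 * (k + l)).+1 ^ (l + (k + l))) ^ D
    <= 2 ^ (C + (x + x) * (x + x) * D).
  rewrite (expnD 2 C) (expnM 2 _ D); apply: leq_mul; first exact/ltnW/ltn_expl.
  by case: (posnP D) => [->//|H]; rewrite leq_exp2r.
apply: leq_trans h3 _; rewrite leq_pexp2l //.
have xE : 2 ^ (x + x) = 2 ^ x * 2 ^ x by rewrite expnD.
have dD : D < 2 ^ D by apply: ltn_expl.
have cC : C < 2 ^ C by apply: ltn_expl.
have -> : 2 ^ (x + x + (3 + D + C)) = 8 * (2 ^ x * 2 ^ x * (2 ^ D * 2 ^ C)).
  by rewrite !expnD; lia.
have h4 : (x + x) * (x + x) * D <= 4 * (2 ^ x * 2 ^ x * 2 ^ D).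
  have : x * x <= 2 ^ x * 2 ^ x by rewrite leq_mul // ltnW.
  by move: (2 ^ x * 2 ^ x) (2 ^ D) dD => a b; nia.
have p1 : 0 < 2 ^ x * 2 ^ x by rewrite muln_gt0 expn_gt0.
have p2 : 0 < 2 ^ D by rewrite expn_gt0.
have p3 : 0 < 2 ^ C by rewrite expn_gt0.
move: h4 cC p1 p2 p3; move: (2 ^ x * 2 ^ x) (2 ^ D) (2 ^ C) => a b c0 h4 cC p1 p2 p3.
have h5 : a * b <= a * (b * c0) by rewrite mulnA leq_pmulr.
have h6 : c0 <= a * (b * c0) by rewrite mulnA leq_pmull // muln_gt0 p1.
by lia.
Qed.

Theorem theorem3p9 :
  (exists f : nat -> nat, ram_computable f /\
    exists (P : program) (c : nat),
      forall (n : nat) (e : rel 'I_n) (S T : {set 'I_n}) (k l d : nat),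
        symmetric e -> irreflexive e ->
        tjo_instance e S T k l -> degenerate e d ->
        exists m, exec P (f (k + l + d) * n ^ c) 0 (init (enc_inst e S T k l))
                    = Some m
                  /\ (accepts m <-> tjo_yes e S T k l))
  /\
  (exists g : nat -> nat, ram_computable g /\
    exists (P : program) (c : nat),
      forall (n : nat) (e : rel 'I_n) (S T : {set 'I_n}) (k l : nat)
             (N : {set 'I_n}) (d : nat),
        symmetric e -> irreflexive e ->
        tjo_instance e S T k l -> degenerate_minus e N d ->
        exists m, exec P (g (#|N| + k + l + d) * n ^ c) 0
                    (init (enc_inst_mod e S T k l N d)) = Some m
                  /\ (accepts m <-> tjo_yes e S T k l)).
Proof.
have [C [D H]] := tjo_program_spec; have [c Hc] := tower_bound C D.
pose f x := 2 ^ (2 ^ (x + x + c)).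
have bound n k l d :
    C * ((d.+1 * (k + l)).+1 ^ (l + (k + l)) * n) ^ D <= f (k + l + d) * n ^ D.
  by rewrite expnMn mulnA leq_mul2r Hc orbT.
split; exists f; split; try exact: tower_computable;
  exists tjo_program, D => n e S T k l.
- move=> d se ie inst De.
  by have := H n e S T k l d [::] _ se ie inst De (bound n k l d); rewrite cats0.
- move=> N d se ie inst De.
  have -> : #|N| + k + l + d = k + l + (#|N| + d) by lia.
  exact: H se ie inst (degenerate_of_minus De) (bound _ _ _ _).
Qed.
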